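(* Let $X$ be a Noetherian $\mathbb{F}_1$-scheme, let $r\ge 1$, and let $a_1,\ldots,a_r\in\mathbb{C}$ with $\Re(a_i)>0$ for all $1\le i\le r$. For each $p\in X$ write $\mathcal{O}_{X,p}^{\times}=\mathbb{Z}^{n(p)}\times\Gamma_p$ with $\Gamma_p$ a finite abelian group, and let $l(p)=\operatorname{lcm}\{\operatorname{ord}(g)\mid g\in\Gamma_p\}$. Let $\zeta(s,q)$ denote the Hurwitz zeta function. Then the deformed multivariable zeta function of Hurwitz-Igusa type $\zeta^{HI}(s_1,\ldots,s_r;a_1,\ldots,a_r;w;X)$ has the following explicit presentation. If $w\in\mathbb{N}$, then $$\zeta^{HI}(s_1,\ldots,s_r;a_1,\ldots,a_r;w;X)=\sum_{p\in X}\ \sum_{j_1,\ldots,j_r=0}^{n(p)w}\left[\prod_{i=1}^r\binom{n(p)w}{j_i}(1-a_i)^{n(p)w-j_i}\right]\left[\sum_{k_1,\ldots,k_r=1}^{l(p)}\bigl|\operatorname{Hom}(\Gamma_p,\mathbb{Z}/k_1\cdots k_r\mathbb{Z})\bigr|^{w}\prod_{i=1}^r l(p)^{-(s_i-j_i)}\,\zeta\!\left(s_i-j_i,\tfrac{k_i-1+a_i}{l(p)}\right)\right].$$ If $a_1=\cdots=a_r=1$ (and $w\in\mathbb{C}$ is arbitrary), then $$\zeta^{HI}(s_1,\ldots,s_r;1,\ldots,1;w;X)=\sum_{p\in X}\ \sum_{k_1,\ldots,k_r=1}^{l(p)}\bigl|\operatorname{Hom}(\Gamma_p,\mathbb{Z}/k_1\cdots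 k_r\mathbb{Z})\bigr|^{w}\prod_{i=1}^r l(p)^{-(s_i-n(p)w)}\,\zeta\!\left(s_i-n(p)w,\tfrac{k_i}{l(p)}\right).$$ In particular: (1) when $w\in\mathbb{N}$, $\zeta^{HI}(s_1,\ldots,s_r;a_1,\ldots,a_r;w;X)$ is a meromorphic function of $s_1,\ldots,s_r$ (that is, it continues meromorphically to $\mathbb{C}^r$); (2) when $a_1=\cdots=a_r=1$, $\zeta^{HI}(s_1,\ldots,s_r;1,\ldots,1;w;X)$ is a meromorphic function of $s_1,\ldots,s_r,w$ (that is, it continues meromorphically to $\mathbb{C}^{r+1}$).
   Context: $\mathbb{N}$ denotes the positive integers. A Noetherian $\mathbb{F}_1$-scheme is taken in the sense of Connes-Consani: its underlying space is a topological space with a sheaf of commutative monoids with absorbing zero, admitting a finite open cover by prime spectra of finitely generated such monoids. The only facts about $X$ that matter here are that $X$ has finitely many points and that, for every $p\in X$, the unit group $\mathcal{O}_{X,p}^{\times}$ of the stalk at $p$ is a finitely generated abelian group. So the data is a finite family $(\mathcal{O}_{X,p}^{\times})_{p\in X}$ of finitely generated abelian groups. $\operatorname{Hom}$ denotes homomorphisms of abelian groups. For a finitely generated abelian group $A$ and $\Re(a_i)>0$ define $$\zeta_{\mathrm{Ab}}^{HI}(s_1,\ldots,s_r;a_1,\ldots,a_r;w;A)=\sum_{m_1,\ldots,m_r\ge 1}\bigl|\operatorname{Hom}(A,\mathbb{Z}/m_1\cdots m_r\mathbb{Z})\bigr|^{w}\,(m_1-1+a_1)^{-s_1}\cdots(m_r-1+a_r)^{-s_r},$$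 and $$\zeta^{HI}(s_1,\ldots,s_r;a_1,\ldots,a_r;w;X)=\sum_{p\in X}\zeta_{\mathrm{Ab}}^{HI}(s_1,\ldots,s_r;a_1,\ldots,a_r;w;\mathcal{O}_{X,p}^{\times}).$$ Complex powers use the principal branch (all bases have positive real part). The series for $X$ converges absolutely when $\Re(s_i)>1+n(p)\Re(w)$ for all $i$ and all $p\in X$, where $n(p)$ is the rank of $\mathcal{O}_{X,p}^\times$. The explicit formulas are identities in that region and provide the meromorphic continuation. The Hurwitz zeta function is $\zeta(s,q)=\sum_{n\ge 0}(n+q)^{-s}$ for $\Re(s)>1$, $\Re(q)>0$, continued meromorphically in $s$ to $\mathbb{C}$. The convention $0^0=1$ is used for $(1-a_i)^{n(p)w-j_i}$. *)

(* Defs.v *)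
From HB Require Import structures.
From mathcomp Require Import all_boot all_order all_algebra all_fingroup.
From mathcomp Require Import finmap complex.
From mathcomp Require Import all_classical all_reals all_analysis.
From mathcomp.analysis.showcase Require summability.

Set Implicit Arguments.
Unset Strict Implicit.
Unset Printing Implicit Defensive.

Import Order.TTheory GRing.Theory Num.Theory.
Import numFieldNormedType.Exports.

Local Open Scope classical_set_scope.
Local Open Scope complex_scope.
Local Open Scope ring_scope.

(* The topology and the normed module structure on R[i] are those that the
   library puts on the regular module of a numFieldType; R[i]^o is R[i]. *)
Notation Cplx R := ((R[i])^o).

Section ComplexPowers.
Context {R : realType}.
Implicit Types z s : R[i].

Definition cmod z : R := Num.sqrt (complex.Re z ^+ 2 + complex.Im z ^+ 2).

(* For z != 0, the argument of z in ]-pi, pi] *)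
Definition carg z : R :=
  if 0 <= complex.Im z then acos (complex.Re z / cmod z)
  else - acos (complex.Re z / cmod z).

Definition clog z : R[i] := ln (cmod z) +i* carg z.

Definition cexp z : R[i] :=
  (expR (complex.Re z) * cos (complex.Im z))
  +i* (expR (complex.Re z) * sin (complex.Im z)).

(* Principal branch; meaningful for z != 0 only *)
Definition cpow z s : R[i] := cexp (s * clog z).

End ComplexPowers.

Section Meromorphic.
Context {R : realType} {V : normedModType R[i]}.

(* On an open set, Frechet differentiability over R[i] at every point is
   holomorphy, in any (finite) number of variables *)
Definition holomorphic_on (U : set V) (f : V -> Cplx R) : Prop :=
  forall z, U z -> differentiable f z.

(* F is locally a quotient g / h of holomorphic functions, where h does not
   vanish identically near any point. The values of the total function F are
   constrained only where some such h does not vanish; on the polar set they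
   are irrelevant *)
Definition meromorphic (F : V -> Cplx R) : Prop :=
  forall z0 : V, exists U : set V, exists g h : V -> Cplx R,
    [/\ open U, U z0, holomorphic_on U g /\ holomorphic_on U h,
        forall z, U z -> ~ (\forall y \near z, h y = 0) &
        forall z, U z -> h z != 0 -> F z = g z / h z].

Definition meromorphic_continuation (D : set V) (f F : V -> Cplx R) : Prop :=
  meromorphic F /\ forall z, D z -> f z = F z.

End Meromorphic.

Section Hurwitz.
Context {R : realType}.

Definition hurwitz_series (s q : R[i]) : Cplx R :=
  limn (series (fun n : nat => cpow (n%:R + q) (- s) : Cplx R)).

Definition is_hurwitz (q : R[i]) (f : Cplx R -> Cplx R) : Prop :=
  [/\ forall s : Cplx R, 1 < complex.Re s -> f s = hurwitz_series s q,
      holomorphic_on [set s : Cplx R | s != 1] f & meromorphic f].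

(* By the identity theorem, is_hurwitz q determines f away from s = 1 *)
Definition hurwitz (s q : R[i]) : R[i] := xget (fun=> 0) (is_hurwitz q) s.

End Hurwitz.

Section AbelianGroups.

Definition fin_gen (A : zmodType) : Prop :=
  exists (k : nat) (g : 'I_k -> A),
    forall x, exists c : 'I_k -> int, x = \sum_(i < k) g i *~ c i.

(* For m >= 1, 'I_m.-1.+1 carries the additive group Z/mZ, also for m = 1
   (where 'Z_m would be Z/2Z) *)
Definition Hom_set (A : zmodType) (m : nat) : set (A -> 'I_m.-1.+1) :=
  [set f : A -> 'I_m.-1.+1 | {morph f : x y / x + y}].

Arguments Hom_set : clear implicits.

Definition card_Hom (A : zmodType) (m : nat) : nat :=
  #|` fset_set (Hom_set A m)|%fset.

Definition lcm_orders (Gamma : finZmodType) : nat :=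
  \big[lcmn/1%N]_(g : Gamma) #[g]%g.

End AbelianGroups.

Section ZetaHI.
Context {R : realType} (r : nat).
Implicit Types (a : 'I_r -> R[i]) (s : 'rV[R[i]]_r) (w : R[i]).

(* The index m stands for (m_1, ..., m_r) = (m 0 + 1, ..., m (r - 1) + 1) *)
Definition zeta_term s a w (A : zmodType) (m : {ffun 'I_r -> nat}) : Cplx R :=
  cpow (card_Hom A (\prod_(i < r) (m i).+1))%:R w
  * \prod_(i < r) cpow ((m i).+1%:R - 1 + a i) (- s 0 i).

Definition zeta_abs_cvg s a w (A : zmodType) : Prop :=
  esum.summable [set: {ffun 'I_r -> nat}]
    (fun m => (cmod (zeta_term s a w A m))%:E).

Definition zetaAb s a w (A : zmodType) : R[i] :=
  summability.sum (zeta_term s a w A).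

Definition zetaHI s a w (X : finType) (G : X -> zmodType) : R[i] :=
  \sum_(p : X) zetaAb s a w (G p).

Definition cvg_region (X : finType) (n : X -> nat) s w : Prop :=
  forall (p : X) (i : 'I_r),
    1 + (n p)%:R * complex.Re w < complex.Re (s 0 i).

(* Here and below, k stands for (k_1, ..., k_r) = (k 0 + 1, ..., k (r-1) + 1),
   and 0 ^+ 0 = 1 *)
Definition zetaHI_nat s a (w : nat) (X : finType) (n : X -> nat)
    (Gamma : X -> finZmodType) : R[i] :=
  \sum_(p : X) \sum_(j : {ffun 'I_r -> 'I_(n p * w).+1})
    (\prod_(i < r) ('C(n p * w, j i)%:R * (1 - a i) ^+ (n p * w - j i)))
    * \sum_(k : {ffun 'I_r -> 'I_(lcm_orders (Gamma p))})
        cpow (card_Hom (Gamma p) (\prod_(i < r) (k i).+1))%:R w%:R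
        * \prod_(i < r)
            (cpow (lcm_orders (Gamma p))%:R (- (s 0 i - (j i)%:R))
             * hurwitz (s 0 i - (j i)%:R)
                 (((k i).+1%:R - 1 + a i) / (lcm_orders (Gamma p))%:R)).

Definition zetaHI_one s w (X : finType) (n : X -> nat)
    (Gamma : X -> finZmodType) : R[i] :=
  \sum_(p : X) \sum_(k : {ffun 'I_r -> 'I_(lcm_orders (Gamma p))})
    cpow (card_Hom (Gamma p) (\prod_(i < r) (k i).+1))%:R w
    * \prod_(i < r)
        (cpow (lcm_orders (Gamma p))%:R (- (s 0 i - (n p)%:R * w))
         * hurwitz (s 0 i - (n p)%:R * w)
             ((k i).+1%:R / (lcm_orders (Gamma p))%:R)).

End ZetaHI.

(* Main.v *)
(* Writing G p = Z^n x Gamma gives |Hom(G p, Z/m)| = m^n |Hom(Gamma, Z/m)|, and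
   |Hom(Gamma, Z/m)| depends only on m modulo l = lcm_orders Gamma, since it is
   unchanged when m is replaced by gcd(m, l). Splitting each m_i along residues
   modulo l turns the multiple series into a finite sum of products of Hurwitz
   series; when w is an integer, m_i^(n w) is first expanded in powers of
   m_i - 1 + a_i by the binomial formula.

   The substance is the continuation of zeta(s, q), obtained without complex
   integration. Summing over n the Taylor expansion of (n + q + u)^(1 - s)
   between u = 0 and u = 1 to order K, the left-hand sides telescope, and
     (s - 1) zeta(s, q) = q^(1 - s)
        - sum_(2 <= k <= K) c_k(s) (s + k - 2) zeta(s + k - 1, q) + R_K(s)
   with polynomials c_k and a series R_K converging for Re s > 1 - K. This
   defines the left-hand side on larger and larger half-planes; that the
   successive definitions agree is a direct computation, so that no identity
   theorem is needed. R_K is differentiable because its terms have second order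
   remainders in s bounded by a summable sequence; this bound is again the Taylor
   inequality in u, applied to the remainders. *)
Require Import Defs.
From HB Require Import structures.
From mathcomp Require Import all_boot all_order all_algebra all_fingroup.
From mathcomp Require Import finmap complex.
From mathcomp Require Import all_classical all_reals all_analysis.
From mathcomp Require Import ring lra.

Set Implicit Arguments.
Unset Strict Implicit.
Unset Printing Implicit Defensive.

Import Order.TTheory GRing.Theory Num.Theory.
Import numFieldNormedType.Exports.

Local Open Scope classical_set_scope.
Local Open Scope complex_scope.
Local Open Scope ring_scope.

(** * Complex powers *)

Section ComplexBasics.
Context {R : realType}.
Implicit Types (z s : R[i]) (x : R).

(** With integration set aside, holomorphy of an infinite sum is not drawn from locally uniform
    convergence: every term needs an explicit bound. The K-th remainder involves powers of size (n +
    1)^(- Re s - K). Differentiating in s brings in logarithms, and moving s by h a factor of size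
    about (n + 1)^|h|. Both are paid for out of the margin Re s + K - 1, so the radius in h shrinks
    towards the edge of the half-plane.

    In several variables, closure of meromorphic functions under sums and products hinges on
    denominators that vanish identically on no open set. Continuity settles products, and each
    Hurwitz factor depends on the variables through a single affine form.

    [hurwitz] is some function satisfying [is_hurwitz], and only that predicate is known of it. The
    bases n + q of the powers have positive real part; there [carg] is an arctangent, so that [clog]
    is smooth and additive under positive real factors. *)

Lemma normC_cmod z : `|z| = (cmod z)%:C.
Proof. exact: normc_def. Qed.

Lemma cmod_normc z : cmod z = Normc.normc z.
Proof. by case: z. Qed.

Lemma cmod_ge0 z : 0 <= cmod z.
Proof. exact: sqrtr_ge0. Qed.

Lemma cmodM z s : cmod (z * s) = cmod z * cmod s.
Proof. by rewrite !cmod_normc Normc.normcM. Qed.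

Lemma cmodD z s : cmod (z + s) <= cmod z + cmod s.
Proof. by rewrite !cmod_normc; exact: le_normcD. Qed.

Lemma cmodN z : cmod (- z) = cmod z.
Proof. by rewrite !cmod_normc normcN. Qed.

Lemma cmodB z s : cmod (z - s) <= cmod z + cmod s.
Proof. by rewrite -(cmodN s); exact: cmodD. Qed.

Lemma cmodC_real x : cmod x%:C = `|x|.
Proof. by rewrite /cmod /= expr0n addr0 sqrtr_sqr. Qed.

Lemma cmod0 : cmod (0 : R[i]) = 0.
Proof. by rewrite (cmodC_real 0) normr0. Qed.

Lemma cmod1 : cmod (1 : R[i]) = 1.
Proof. by rewrite (cmodC_real 1) normr1. Qed.

Lemma cmod_eq0 z : (cmod z == 0) = (z == 0).
Proof.
apply/eqP/eqP => [|->]; last exact: cmod0.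
by rewrite cmod_normc; exact: Normc.eq0_normc.
Qed.

Lemma cmod_gt0 z : (0 < cmod z) = (z != 0).
Proof. by rewrite lt_def cmod_eq0 cmod_ge0 andbT. Qed.

Lemma cmodV z : cmod z^-1 = (cmod z)^-1.
Proof. by rewrite !cmod_normc Normc.normcV. Qed.

Lemma cmodX z n : cmod (z ^+ n) = cmod z ^+ n.
Proof. by elim: n => [|n IH]; rewrite ?expr0 ?cmod1// !exprS cmodM IH. Qed.

Lemma cmod_sum (I : Type) (s : seq I) (P : pred I) (F : I -> R[i]) :
  cmod (\sum_(i <- s | P i) F i) <= \sum_(i <- s | P i) cmod (F i).
Proof.
elim/big_ind2: _ => [|x1 x2 y1 y2 h1 h2|//]; first by rewrite cmod0.
exact: le_trans (cmodD _ _) (lerD h1 h2).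
Qed.

Lemma cmod_prod (I : Type) (s : seq I) (P : pred I) (F : I -> R[i]) :
  cmod (\prod_(i <- s | P i) F i) = \prod_(i <- s | P i) cmod (F i).
Proof. by elim/big_rec2: _ => [|i x y _ <-]; rewrite ?cmod1 ?cmodM. Qed.

Lemma cmod_nat n : cmod (n%:R : R[i]) = n%:R.
Proof.
have -> : (n%:R : R[i]) = (n%:R : R)%:C by rewrite rmorph_nat.
by rewrite cmodC_real ger0_norm.
Qed.

Lemma Re_nat n : complex.Re (n%:R : R[i]) = n%:R.
Proof. by have -> : (n%:R : R[i]) = (n%:R : R)%:C by rewrite rmorph_nat. Qed.

Lemma Im_nat n : complex.Im (n%:R : R[i]) = 0.
Proof. by have -> : (n%:R : R[i]) = (n%:R : R)%:C by rewrite rmorph_nat. Qed.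

Lemma natC n : (n%:R : R[i]) = (n%:R : R)%:C.
Proof. by rewrite rmorph_nat. Qed.

Lemma ReD z s : complex.Re (z + s) = complex.Re z + complex.Re s.
Proof. by case: z; case: s. Qed.

Lemma ImD z s : complex.Im (z + s) = complex.Im z + complex.Im s.
Proof. by case: z; case: s. Qed.

Lemma ReN z : complex.Re (- z) = - complex.Re z.
Proof. by case: z. Qed.

Lemma ImN z : complex.Im (- z) = - complex.Im z.
Proof. by case: z. Qed.

Lemma ReM z s :
  complex.Re (z * s) = complex.Re z * complex.Re s - complex.Im z * complex.Im s.
Proof. by case: z; case: s. Qed.

Lemma ImM z s :
  complex.Im (z * s) = complex.Re z * complex.Im s + complex.Im z * complex.Re s.
Proof. by case: z; case: s. Qed.

Lemma complex_eq z s :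
  complex.Re z = complex.Re s -> complex.Im z = complex.Im s -> z = s.
Proof. by case: z; case: s => /= a b c d -> ->. Qed.

Lemma Re_le_cmod z : `|complex.Re z| <= cmod z.
Proof. by rewrite -sqrtr_sqr ler_sqrt ?addr_ge0 ?sqr_ge0// lerDl sqr_ge0. Qed.

Lemma Im_le_cmod z : `|complex.Im z| <= cmod z.
Proof. by rewrite -sqrtr_sqr ler_sqrt ?addr_ge0 ?sqr_ge0// lerDr sqr_ge0. Qed.

Lemma cmod_le_ReIm z : cmod z <= `|complex.Re z| + `|complex.Im z|.
Proof.
rewrite -[leRHS]ger0_norm ?addr_ge0// -sqrtr_sqr ler_sqrt ?sqr_ge0//.
rewrite sqrrD !real_normK ?num_real// addrAC lerDl.
by rewrite mulrn_wge0// mulr_ge0.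
Qed.

Lemma sqr_cmod z : cmod z ^+ 2 = complex.Re z ^+ 2 + complex.Im z ^+ 2.
Proof. by rewrite sqr_sqrtr// addr_ge0 ?sqr_ge0. Qed.

Lemma cexpD z s : cexp (z + s) = cexp z * cexp s.
Proof.
by apply: complex_eq; rewrite ?ReM ?ImM /= ReD ImD expRD ?cosD ?sinD; ring.
Qed.

Lemma cexp0 : cexp (0 : R[i]) = 1.
Proof. by apply: complex_eq; rewrite /= expR0 ?cos0 ?sin0 mul1r. Qed.

Lemma cmod_cexp z : cmod (cexp z) = expR (complex.Re z).
Proof.
rewrite /cmod /= !exprMn -mulrDr cos2Dsin2 mulr1 sqrtr_sqr.
by rewrite ger0_norm// expR_ge0.
Qed.

Lemma cexp_neq0 z : cexp z != 0.
Proof. by rewrite -cmod_gt0 cmod_cexp expR_gt0. Qed.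

Lemma cexpN z : cexp (- z) = (cexp z)^-1.
Proof.
by apply: (mulfI (cexp_neq0 z)); rewrite -cexpD subrr cexp0 divff// cexp_neq0.
Qed.

Lemma cexpMn z n : cexp (n%:R * z) = cexp z ^+ n.
Proof.
elim: n => [|n IH]; first by rewrite mul0r cexp0 expr0.
by rewrite exprS -IH -cexpD mulrSr mulrDl mul1r addrC.
Qed.

Lemma Re_div_cmod z : z != 0 -> -1 <= complex.Re z / cmod z <= 1.
Proof.
move=> z0; rewrite -ler_norml normrM normfV (ger0_norm (cmod_ge0 z)).
by rewrite ler_pdivrMr ?cmod_gt0// mul1r Re_le_cmod.
Qed.

Lemma cexp_clog z : z != 0 -> cexp (clog z) = z.
Proof.
move=> z0; have m0 : 0 < cmod z by rewrite cmod_gt0.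
have itv := Re_div_cmod z0.
have sinE : cmod z * sin (acos (complex.Re z / cmod z)) = `|complex.Im z|.
  rewrite sin_acos// -[X in X * _](ger0_norm (cmod_ge0 z)) -sqrtr_sqr.
  rewrite -sqrtrM ?sqr_ge0// mulrBr mulr1 exprMn mulrCA exprVn divff ?mulr1.
    by rewrite sqr_cmod addrC addKr sqrtr_sqr.
  by rewrite sqrf_eq0 gt_eqF.
have cosE : cmod z * cos (acos (complex.Re z / cmod z)) = complex.Re z.
  by rewrite acosK ?in_itv//= mulrC divfK// gt_eqF.
apply: complex_eq; rewrite /= lnK ?posrE// /carg.
  by case: ifP => _; rewrite ?cosN.
case: ifPn => [im0|]; first by rewrite sinE ger0_norm.
rewrite -ltNge => im0.
by rewrite sinN mulrN sinE ltr0_norm// opprK.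
Qed.

(** On the right half-plane the two cases of [carg] merge into one formula that is smooth in both
    coordinates. The derivative of [clog] and its additivity under positive scaling are read off
    from it. *)
Lemma carg_atan z : 0 < complex.Re z ->
  carg z = atan (complex.Im z / complex.Re z).
Proof.
move=> rez; have z0 : z != 0 by apply: contraTneq rez => ->; rewrite ltxx.
have m0 : 0 < cmod z by rewrite cmod_gt0.
set t := complex.Im z / complex.Re z.
have cosE : complex.Re z / cmod z = cos (atan t).
  rewrite cos_atan; have -> : 1 + t ^+ 2 = (cmod z / complex.Re z) ^+ 2.
    by rewrite [RHS]expr_div_n sqr_cmod /t; field; rewrite gt_eqF.
  by rewrite sqrtr_sqr ger0_norm ?divr_ge0 ?cmod_ge0 ?ltW// invf_div.
have tlt := atan_ltpi2 t; have tgt := atan_gtNpi2 t.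
have pi0 := @pi_gt0 R.
rewrite /carg; case: ifPn => [im0|].
  rewrite cosE cosK// in_itv /=; apply/andP; split; last by lra.
  by rewrite -atan0; apply: le_atan; rewrite divr_ge0// ltW.
rewrite -ltNge => im0; rewrite cosE cosKN ?opprK//.
apply/andP; split; first by lra.
rewrite -atan0; apply: le_atan.
by rewrite pmulr_lle0 ?invr_gt0// ltW.
Qed.

Lemma carg_bound z : 0 < complex.Re z -> `|carg z| <= 2.
Proof.
move=> rez; rewrite carg_atan// ler_norml.
have := atan_ltpi2 (complex.Im z / complex.Re z).
have := atan_gtNpi2 (complex.Im z / complex.Re z).
have := @pihalf_lt2 R.
by move=> *; apply/andP; split; lra.
Qed.

Lemma clog_real x : 0 < x -> clog x%:C = (ln x)%:C.
Proof.
move=> x0; rewrite /clog cmodC_real gtr0_norm//; congr (_ +i* _).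
by rewrite carg_atan//= mul0r atan0.
Qed.

Lemma clogM_real x z : 0 < x -> 0 < complex.Re z ->
  clog (x%:C * z) = clog x%:C + clog z.
Proof.
move=> x0 rez; have z0 : z != 0 by apply: contraTneq rez => ->; rewrite ltxx.
have rex : 0 < complex.Re (x%:C * z) by rewrite ReM /= mul0r subr0 mulr_gt0.
rewrite clog_real// /clog cmodM cmodC_real gtr0_norm// lnM ?posrE ?cmod_gt0//.
rewrite !carg_atan// ReM ImM /= !mul0r subr0 addr0.
apply: complex_eq => //=; rewrite add0r; congr atan; field.
by rewrite !gt_eqF.
Qed.

Lemma cpowD z s t : cpow z (s + t) = cpow z s * cpow z t.
Proof. by rewrite /cpow mulrDl cexpD. Qed.

Lemma cpowN z s : cpow z (- s) = (cpow z s)^-1.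
Proof. by rewrite /cpow mulNr cexpN. Qed.

Lemma cpow_nat z n : z != 0 -> cpow z n%:R = z ^+ n.
Proof. by move=> z0; rewrite /cpow cexpMn cexp_clog. Qed.

(** False for two general factors, whose arguments may add up past pi; a positive real factor leaves
    the argument unchanged. *)
Lemma cpowMr x z s : 0 < x -> 0 < complex.Re z ->
  cpow (x%:C * z) s = cpow x%:C s * cpow z s.
Proof. by move=> x0 z0; rewrite /cpow clogM_real// mulrDr cexpD. Qed.

Lemma clog1 : clog (1 : R[i]) = 0.
Proof. by rewrite (clog_real ltr01) ln1. Qed.

Lemma cpow1l s : cpow 1 s = 1.
Proof. by rewrite /cpow clog1 mulr0 cexp0. Qed.

Lemma cpow_prod_nat (I : Type) (r : seq I) (F : I -> nat) s :
  (forall i, (0 < F i)%N) ->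
  cpow (\prod_(i <- r) F i)%N%:R s = \prod_(i <- r) cpow (F i)%:R s.
Proof.
move=> F0; elim: r => [|i r IH]; first by rewrite !big_nil cpow1l.
rewrite !big_cons -IH natrM natC cpowMr ?ltr0n//.
by rewrite Re_nat ltr0n prodn_gt0.
Qed.

Lemma cpow_natX (m k : nat) s : (0 < m)%N ->
  cpow (m ^ k)%N%:R s = cpow m%:R (k%:R * s).
Proof.
move=> m0; rewrite /cpow (natC (m ^ k)) (natC m) !clog_real ?ltr0n ?expn_gt0 ?m0//.
by congr cexp; rewrite natrX lnXn ?ltr0n// raddfMn /= -(mulr_natl _ k); ring.
Qed.

Lemma cmod_cpow z s : cmod (cpow z s) =
  expR (complex.Re s * ln (cmod z) - complex.Im s * carg z).
Proof. by rewrite /cpow cmod_cexp ReM. Qed.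

End ComplexBasics.

(** * Convergence and differentiability in one complex variable *)

Section ComplexTopology.
Context {R : realType}.
Implicit Types (z s : R[i]) (x : R).

(* Convergence is handled at type R[i] rather than at its convertible copy
   R[i]^o, on which the library defines the topology. *)
Definition ccvg (u : nat -> R[i]) (l : R[i]) : Prop :=
  forall e : R, 0 < e -> exists N, forall n, (N <= n)%N -> cmod (l - u n) < e.

Definition csums (u : nat -> R[i]) (l : R[i]) : Prop :=
  ccvg (fun N => \sum_(0 <= n < N) u n) l.

Lemma gt0_complexE (e : R[i]) : 0 < e -> e = (complex.Re e)%:C /\ 0 < complex.Re e.
Proof. by case: e => a b; rewrite ltcE /= => /andP[/eqP -> a0]. Qed.

Lemma cvg_cmodP (T : Type) (F : set_system T) {FF : Filter F}
    (f : T -> Cplx R) (l : Cplx R) :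
  f @ F --> l <-> forall e : R, 0 < e -> \forall t \near F, cmod (l - f t) < e.
Proof.
split=> [/cvgrPdist_lt h e e0|h].
  have e0' : 0 < e%:C by rewrite ltcR.
  have := h _ e0'; apply: filterS => t.
  by rewrite normC_cmod ltcR.
apply/cvgrPdist_lt => e /gt0_complexE[-> e0].
by have := h _ e0; apply: filterS => t; rewrite normC_cmod ltcR.
Qed.

Lemma cvgn_ccvg (f : nat -> Cplx R) (l : Cplx R) : f @ \oo --> l <-> ccvg f l.
Proof.
split=> [/cvg_cmodP h e e0|h].
  by have [N _ hN] := h e e0; exists N => n Nn; exact: hN.
apply/cvg_cmodP => e e0; have [N hN] := h e e0.
by exists N => // n /=; exact: hN.
Qed.

Lemma limn_ccvg (f : nat -> Cplx R) (l : R[i]) : ccvg f l -> limn f = l.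
Proof. by move=> /cvgn_ccvg fl; apply/cvg_lim => //; exact: norm_hausdorff. Qed.

Lemma ccvg_unique (u : nat -> R[i]) (a b : R[i]) : ccvg u a -> ccvg u b -> a = b.
Proof.
by move=> /limn_ccvg <- /limn_ccvg <-.
Qed.

Lemma ccvg_ext (u v : nat -> R[i]) (a : R[i]) : u =1 v -> ccvg u a -> ccvg v a.
Proof. by move=> /funext ->. Qed.

Lemma ccvg_cst (a : R[i]) : ccvg (fun=> a) a.
Proof. by move=> e e0; exists 0%N => n _; rewrite subrr cmod0. Qed.

Lemma ccvgZ (u : nat -> R[i]) (a c : R[i]) : ccvg u a -> ccvg (fun n => c * u n) (c * a).
Proof.
move=> ua e e0.
have c0 : 0 < cmod c + 1 by rewrite ltr_wpDl ?cmod_ge0.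
have [N hN] := ua _ (divr_gt0 e0 c0); exists N => n /hN.
rewrite -mulrBr cmodM ltr_pdivlMr// mulrC; apply: le_lt_trans.
by rewrite ler_wpM2r ?cmod_ge0// lerDl.
Qed.

Lemma ccvgD (u v : nat -> R[i]) (a b : R[i]) :
  ccvg u a -> ccvg v b -> ccvg (fun n => u n + v n) (a + b).
Proof.
move=> ua vb e e0; have e2 : 0 < e / 2 by rewrite divr_gt0.
have [N1 h1] := ua _ e2; have [N2 h2] := vb _ e2.
exists (maxn N1 N2) => n; rewrite geq_max => /andP[/h1 k1 /h2 k2].
have -> : a + b - (u n + v n) = (a - u n) + (b - v n) by ring.
by rewrite [ltRHS]splitr; apply: le_lt_trans (cmodD _ _) (ltrD k1 k2).
Qed.

Lemma ccvgB (u v : nat -> R[i]) (a b : R[i]) :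
  ccvg u a -> ccvg v b -> ccvg (fun n => u n - v n) (a - b).
Proof.
move=> ua /(ccvgZ (-1)); rewrite mulN1r => vb.
by apply: ccvg_ext (ccvgD ua vb) => n; rewrite mulN1r.
Qed.

Lemma ccvg_bounded (u : nat -> R[i]) (a : R[i]) (B : R) :
  ccvg u a -> (forall n, cmod (u n) <= B) -> cmod a <= B.
Proof.
move=> ua uB; rewrite leNgt; apply/negP => Ba.
have [N /(_ N (leqnn N))] := ua (cmod a - B) (ltac:(by rewrite subr_gt0)).
apply/negP; rewrite -leNgt lerBlDr -{1}(subrK (u N) a).
by apply: le_trans (cmodD _ _) _; rewrite lerD2l.
Qed.

Lemma ccvgM (u v : nat -> R[i]) (a b : R[i]) :
  ccvg u a -> ccvg v b -> ccvg (fun n => u n * v n) (a * b).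
Proof.
move=> /cvgn_ccvg ua /cvgn_ccvg vb; apply/cvgn_ccvg.
exact: (@cvgM _ _ _ _ (u : nat -> Cplx R) (v : nat -> Cplx R) a b ua vb).
Qed.

Lemma ccvg_prod (I : Type) (s : seq I) (u : I -> nat -> R[i]) (a : I -> R[i]) :
  (forall i, ccvg (u i) (a i)) ->
  ccvg (fun n => \prod_(i <- s) u i n) (\prod_(i <- s) a i).
Proof.
move=> ua; elim: s => [|i s IH].
  by rewrite big_nil; apply: ccvg_ext (ccvg_cst 1) => n; rewrite big_nil.
by rewrite big_cons; apply: ccvg_ext (ccvgM (ua i) IH) => n; rewrite big_cons.
Qed.

Lemma ccvg_sum (I : Type) (s : seq I) (u : I -> nat -> R[i]) (a : I -> R[i]) :
  (forall i, ccvg (u i) (a i)) ->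
  ccvg (fun n => \sum_(i <- s) u i n) (\sum_(i <- s) a i).
Proof.
move=> ua; elim: s => [|i s IH].
  by rewrite big_nil; apply: ccvg_ext (ccvg_cst 0) => n; rewrite big_nil.
by rewrite big_cons; apply: ccvg_ext (ccvgD (ua i) IH) => n; rewrite big_cons.
Qed.

Lemma csums_ext (u v : nat -> R[i]) (a : R[i]) : u =1 v -> csums u a -> csums v a.
Proof. by move=> /funext ->. Qed.

Lemma csumsD (u v : nat -> R[i]) (a b : R[i]) :
  csums u a -> csums v b -> csums (fun n => u n + v n) (a + b).
Proof.
by move=> ua vb; apply: ccvg_ext (ccvgD ua vb) => n; rewrite big_split.
Qed.

Lemma csumsZ (u : nat -> R[i]) (a c : R[i]) :
  csums u a -> csums (fun n => c * u n) (c * a).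
Proof.
by move=> ua; apply: ccvg_ext (ccvgZ c ua) => n; rewrite mulr_sumr.
Qed.

Lemma csums_sum (I : Type) (s : seq I) (u : I -> nat -> R[i]) (a : I -> R[i]) :
  (forall i, csums (u i) (a i)) ->
  csums (fun n => \sum_(i <- s) u i n) (\sum_(i <- s) a i).
Proof.
move=> ua; apply: ccvg_ext (ccvg_sum s ua) => n.
by rewrite exchange_big.
Qed.

Lemma abs_csums (u : nat -> R[i]) (B : R) :
  (forall N, \sum_(0 <= n < N) cmod (u n) <= B) ->
  exists2 l : R[i], csums u l & cmod l <= B.
Proof.
move=> uB.
have part (g : R[i] -> R) : (forall z, `|g z| <= cmod z) ->
    cvgn (series (fun n => g (u n))).
  move=> gle; apply: normed_cvg.
  apply: nondecreasing_is_cvgn.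
    by apply: nondecreasing_series => *; exact: normr_ge0.
  exists B => _ [N _ <-]; apply: le_trans (uB N).
  by rewrite /series /=; apply: ler_sum => i _; exact: gle.
have /cvg_ex[/= a ua] := part _ Re_le_cmod.
have /cvg_ex[/= b ub] := part _ Im_le_cmod.
have ul : csums u (a +i* b).
  move=> e e0; have e2 : 0 < e / 2 by rewrite divr_gt0.
  move/cvgrPdist_lt : ua => /(_ _ e2)[N1 _ h1].
  move/cvgrPdist_lt : ub => /(_ _ e2)[N2 _ h2].
  exists (maxn N1 N2) => n; rewrite geq_max => /andP[n1 n2].
  have := h1 n n1; have := h2 n n2; rewrite /series /= => k2 k1.
  apply: le_lt_trans (cmod_le_ReIm _) _.
  have rE : complex.Re (\sum_(0 <= k < n) u k) = \sum_(0 <= k < n) complex.Re (u k).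
    by apply: (big_morph (@complex.Re R)) => //; exact: ReD.
  have iE : complex.Im (\sum_(0 <= k < n) u k) = \sum_(0 <= k < n) complex.Im (u k).
    by apply: (big_morph (@complex.Im R)) => //; exact: ImD.
  rewrite ReD ImD ReN ImN rE iE /= [ltRHS]splitr.
  by rewrite ltrD.
exists (a +i* b) => //; apply: ccvg_bounded ul _ => N.
by apply: le_trans (cmod_sum _ _ _) _; exact: uB.
Qed.

(** A quadratic error bound replaces the usual little-o because quadratic bounds of the terms of a
    series can be added up. *)
Lemma differentiable_cplx (f : Cplx R -> Cplx R) (z d : R[i]) (M r : R) :
  0 < r ->
  (forall h : R[i], cmod h < r ->
     cmod ((f (z + h) : R[i]) - f z - h * d) <= M * cmod h ^+ 2) ->
  differentiable f (z : Cplx R).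
Proof.
move=> r0 fM; apply/derivable1_diffP; rewrite /derivable.
apply/cvg_ex; exists d; apply/cvg_cmodP => e e0.
(* [M] may be zero or negative, so the radius e / M needs a positive substitute. *)
pose M' := Num.max M 1.
have M0 : 0 < M' by rewrite lt_max ltr01 orbT.
have m0 : 0 < Num.min r (e / M') by rewrite lt_min r0 divr_gt0.
exists (Num.min r (e / M'))%:C; first by rewrite /= ltcR.
move=> h /=; rewrite sub0r normrN normC_cmod ltcR lt_min => /andP[hr he] h0.
have hpos : 0 < cmod h by rewrite cmod_gt0.
have -> : d - h^-1 *: (f (h *: 1 + z) - f z) =
   - (h^-1 * (f (z + h) - f z - h * d)).
  rewrite [h *: 1]mulr1 (addrC h z).
  have alg (a b c k : R[i]) : k != 0 -> c - k^-1 * (a - b) = - (k^-1 * (a - b - k * c)).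
    by move=> k0; field.
  exact: alg.
rewrite cmodN cmodM cmodV mulrC ltr_pdivrMr//.
apply: le_lt_trans (fM _ hr) _.
rewrite expr2 mulrA ltr_pM2r//.
apply: le_lt_trans (_ : M' * cmod h < _); last by rewrite mulrC -ltr_pdivlMr.
by rewrite ler_wpM2r ?cmod_ge0// le_max lexx.
Qed.

(* Termwise differentiation without uniform convergence: a summable bound for
   the second order remainders suffices. *)
Lemma differentiable_csums (f : nat -> R[i] -> R[i]) (g : nat -> R[i])
    (F : Cplx R -> Cplx R) (z : R[i]) (M : nat -> R) (B r : R) :
  0 < r ->
  (forall N, \sum_(0 <= n < N) M n <= B) ->
  (forall n, cmod (g n) <= M n) ->
  (forall n (h : R[i]), cmod h < r ->
     cmod (f n (z + h) - f n z - h * g n) <= M n * cmod h ^+ 2) ->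
  (forall h : R[i], cmod h < r -> csums (f ^~ (z + h)) (F (z + h))) ->
  differentiable F (z : Cplx R).
Proof.
move=> r0 MB gM fM FE.
have [|d gd _] := @abs_csums g B.
  by move=> N; apply: le_trans (MB N); exact: ler_sum.
apply: (@differentiable_cplx F z d B r r0) => h hr.
have F0 : csums (f ^~ z) (F z).
  by have := FE 0; rewrite cmod0 addr0; apply.
apply: (@ccvg_bounded (fun N => \sum_(0 <= n < N) (f n (z + h) - f n z - h * g n))).
  apply: ccvg_ext (ccvgB (ccvgB (FE _ hr) F0) (ccvgZ h gd)) => N.
  by rewrite !sumrB mulr_sumr.
move=> N; apply: le_trans (cmod_sum _ _ _) _.
apply: le_trans (_ : \sum_(0 <= n < N) (M n * cmod h ^+ 2) <= _).
  by apply: ler_sum => i _; exact: fM.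
by rewrite -mulr_suml ler_wpM2r ?sqr_ge0.
Qed.

End ComplexTopology.

(** * Taylor inequality along real segments *)

Section RealPaths.
Context {R : realType}.
Implicit Types (z s x y : R[i]) (u t : R) (f g : R -> R).

Lemma is_derive_eqf f u a b : is_derive u 1 f a -> a = b -> is_derive u 1 f b.
Proof. by move=> h <-. Qed.

Lemma is_deriveDf f g u a b : is_derive u 1 f a -> is_derive u 1 g b ->
  is_derive u 1 (fun t => f t + g t) (a + b).
Proof. by move=> fa gb; exact: is_deriveD. Qed.

Lemma is_deriveBf f g u a b : is_derive u 1 f a -> is_derive u 1 g b ->
  is_derive u 1 (fun t => f t - g t) (a - b).
Proof. by move=> fa gb; exact: is_deriveB. Qed.

Lemma is_deriveMf f g u a b : is_derive u 1 f a -> is_derive u 1 g b ->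
  is_derive u 1 (fun t => f t * g t) (f u * b + g u * a).
Proof. by move=> fa gb; exact: is_deriveM. Qed.

Lemma is_derive_compf f g u a b :
  is_derive (g u) 1 f a -> is_derive u 1 g b ->
  is_derive u 1 (fun t => f (g t)) (a * b).
Proof. by move=> fa gb; exact: is_derive1_comp. Qed.

(** Split into coordinates because the mean value theorem, applied below, holds for real-valued
    functions only. *)
Definition cderiv (phi : R -> R[i]) u (d : R[i]) : Prop :=
  is_derive u 1 (fun t => complex.Re (phi t)) (complex.Re d) /\
  is_derive u 1 (fun t => complex.Im (phi t)) (complex.Im d).

Lemma cderiv_cst (c : R[i]) u : cderiv (fun=> c) u 0.
Proof. by split; exact: is_derive_cst. Qed.

Lemma cderivD (phi psi : R -> R[i]) u a b :
  cderiv phi u a -> cderiv psi u b -> cderiv (fun t => phi t + psi t) u (a + b).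
Proof.
move=> [p1 p2] [q1 q2]; split.
  rewrite ReD; under eq_fun do rewrite ReD; exact: is_deriveDf.
by rewrite ImD; under eq_fun do rewrite ImD; exact: is_deriveDf.
Qed.

Lemma cderivM (phi psi : R -> R[i]) u a b :
  cderiv phi u a -> cderiv psi u b ->
  cderiv (fun t => phi t * psi t) u (a * psi u + phi u * b).
Proof.
move=> [p1 p2] [q1 q2]; split.
  rewrite ReD !ReM; under eq_fun do rewrite ReM.
  apply: is_derive_eqf (is_deriveBf (is_deriveMf p1 q1) (is_deriveMf p2 q2)) _.
  by ring.
rewrite ImD !ImM; under eq_fun do rewrite ImM.
apply: is_derive_eqf (is_deriveDf (is_deriveMf p1 q2) (is_deriveMf p2 q1)) _.
by ring.
Qed.

Lemma cderivZ (c : R[i]) (phi : R -> R[i]) u a :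
  cderiv phi u a -> cderiv (fun t => c * phi t) u (c * a).
Proof.
by move=> /(cderivM (cderiv_cst c u)); rewrite mul0r add0r.
Qed.

Lemma cderiv_real f u a : is_derive u 1 f a -> cderiv (fun t => (f t)%:C) u a%:C.
Proof. by move=> fa; split => //=; exact: is_derive_cst. Qed.

Lemma cderiv_sum n (phi : nat -> R -> R[i]) u (d : nat -> R[i]) :
  (forall k, (k < n)%N -> cderiv (phi k) u (d k)) ->
  cderiv (fun t => \sum_(k < n) phi k t) u (\sum_(k < n) d k).
Proof.
elim: n => [|n IH] h.
  by under eq_fun do rewrite big_ord0; rewrite big_ord0; exact: cderiv_cst.
under eq_fun do rewrite big_ord_recr/=; rewrite big_ord_recr /=.
by apply: cderivD; [apply: IH => k kn; apply: h; exact: ltnW|exact: h].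
Qed.

Lemma cderiv_cexp (phi : R -> R[i]) u a :
  cderiv phi u a -> cderiv (fun t => cexp (phi t)) u (a * cexp (phi u)).
Proof.
move=> [p1 p2]; split => /=.
  apply: is_derive_eqf (is_deriveMf (is_derive_compf (is_derive_expR _) p1)
    (is_derive_compf (is_derive_cos _) p2)) _.
  by rewrite ReM /=; ring.
apply: is_derive_eqf (is_deriveMf (is_derive_compf (is_derive_expR _) p1)
  (is_derive_compf (is_derive_sin _) p2)) _.
by rewrite ImM /=; ring.
Qed.

Lemma cderiv_clog x u : 0 < complex.Re x + u ->
  cderiv (fun t => clog (x + t%:C)) u (x + u%:C)^-1.
Proof.
case: x => a b /= au0.
have sq0 : 0 < (a + u) ^+ 2 + b ^+ 2 by rewrite ltr_wpDr ?sqr_ge0 ?exprn_gt0.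
have dl : is_derive u 1 (fun t => a + t) 1.
  apply: is_derive_eqf (is_deriveDf (is_derive_cst a u 1) (is_derive_id u 1)) _.
  exact: add0r.
split => /=; rewrite !addr0.
  rewrite /cmod /=; under eq_fun do rewrite addr0 2!expr2.
  rewrite !expr2 in sq0.
  have s0 : 0 < Num.sqrt ((a + u) * (a + u) + b * b) by rewrite sqrtr_gt0.
  have d1 := is_deriveDf (is_deriveMf dl dl) (is_derive_cst (b * b) u 1).
  have d2 := @is_derive_compf Num.sqrt (fun t => (a + t) * (a + t) + b * b) u _ _
    (is_derive1_sqrt sq0) d1.
  have d3 := @is_derive_compf (@ln R)
    (fun t => Num.sqrt ((a + t) * (a + t) + b * b)) u _ _ (is_derive1_ln s0) d2.
  apply: is_derive_eqf d3 _.
  have := sqr_sqrtr (ltW sq0); set w := Num.sqrt _ => wE.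
  have w0 : w != 0 by rewrite gt_eqF// sqrtr_gt0.
  rewrite -wE; field; exact: w0.
have h : is_derive u 1 (fun t => atan (b / (a + t))) (- (b / ((a + u) ^+ 2 + b ^+ 2))).
  have au : a + u != 0 by rewrite gt_eqF.
  have d1 := is_deriveMf (is_derive_cst b u 1) (is_deriveV au dl).
  have d2 := @is_derive_compf (@atan R) (fun t => b * (a + t)^-1) u _ _
    (is_derive1_atan _) d1.
  apply: is_derive_eqf d2 _.
  rewrite /GRing.scale /=; field; rewrite gt_eqF//= gt_eqF//.
(* The arctangent formula for [carg] is available only where the real part is positive, hence near
   [u] rather than everywhere. *)
apply: near_eq_is_derive h.
near=> t; rewrite carg_atan /= ?addr0//.
rewrite -ltrBlDl sub0r; near: t; apply: lt_nbhsr.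
by rewrite -subr_gt0 opprK addrC.
Unshelve. all: by end_near. Qed.

Lemma cderiv_cpow x s u : 0 < complex.Re x + u ->
  cderiv (fun t => cpow (x + t%:C) s) u (s * cpow (x + u%:C) (s - 1)).
Proof.
move=> xu; have xu0 : x + u%:C != 0.
  by apply: contraTneq xu => /(congr1 (@complex.Re R)); rewrite ReD /= => ->; rewrite ltxx.
have := cderiv_cexp (cderivZ s (cderiv_clog xu)).
rewrite (_ : s * _ * _ = s * cpow (x + u%:C) (s - 1))//.
rewrite -mulrA; congr (_ * _); rewrite cpowD cpowN mulrC; congr (_ * _^-1).
by rewrite /cpow mul1r cexp_clog.
Qed.

Lemma MVT_bound f (df : R -> R) (v M : R) : 0 <= v -> v <= 1 ->
  (forall t, 0 <= t <= 1 -> is_derive t 1 f (df t)) ->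
  (forall t, 0 <= t <= 1 -> `|df t| <= M) -> `|f v - f 0| <= M.
Proof.
move=> v0 v1 fd dfM.
have [||c] := @MVT_segment R f df 0 v v0.
- move=> x; rewrite in_itv /= => /andP[/ltW x0 /ltW xv]; apply: fd.
  by rewrite x0 (le_trans xv).
- apply: derivable_within_continuous => x; rewrite in_itv /= => /andP[x0 xv].
  have xi : 0 <= x <= 1 by rewrite x0 (le_trans xv).
  by have [] := fd _ xi.
rewrite in_itv /= => /andP[c0 cv] ->; rewrite subr0 normrM.
have := dfM c; rewrite c0 (le_trans cv v1) => /(_ isT) h.
rewrite (ger0_norm v0); apply: le_trans h.
by rewrite ler_piMr.
Qed.

(** The factor 2 comes from applying the mean value theorem to each coordinate. *)
Lemma cmod_path_bound (phi dphi : R -> R[i]) (v M : R) : 0 <= v <= 1 ->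
  (forall t, 0 <= t <= 1 -> cderiv phi t (dphi t)) ->
  (forall t, 0 <= t <= 1 -> cmod (dphi t) <= M) ->
  cmod (phi v - phi 0) <= 2 * M.
Proof.
move=> /andP[v0 v1] pd dM; apply: le_trans (cmod_le_ReIm _) _.
rewrite mulrDl mul1r; apply: lerD.
  rewrite ReD ReN.
  apply: (@MVT_bound (fun t => complex.Re (phi t)) (fun t => complex.Re (dphi t))
    v M v0 v1) => [t /pd[]//|t /dM].
  exact: le_trans (Re_le_cmod _).
rewrite ImD ImN.
  apply: (@MVT_bound (fun t => complex.Im (phi t)) (fun t => complex.Im (dphi t))
    v M v0 v1) => [t /pd[]//|t /dM].
  exact: le_trans (Im_le_cmod _).
Qed.

(** Induction on [K]: the derivative of a Taylor remainder of [psi] is the remainder, one order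
    lower, of the shifted family [psi k.+1], and each passage back costs a factor 2. Only a chain of
    successive derivatives is assumed, so linear combinations of chains qualify as well. *)
Lemma cmod_taylor_bound K (psi : nat -> R -> R[i]) (v M : R) : 0 <= v <= 1 ->
  (forall k t, 0 <= t <= 1 -> cderiv (psi k) t (psi k.+1 t)) ->
  (forall t, 0 <= t <= 1 -> cmod (psi K.+1 t) <= M) ->
  cmod (psi 0 v - \sum_(k < K.+1) psi k 0 * (v ^+ k / k`!%:R)%:C) <= 2 ^+ K.+1 * M.
Proof.
elim: K psi v => [|K IH] psi v v01 pd pM.
  rewrite big_ord1 expr0 divr1 mulr1 expr1.
  apply: (@cmod_path_bound (psi 0) (psi 1) v M v01) => // t t01.
  exact: pd.
pose T (t : R) := \sum_(k < K.+2) psi k 0 * (t ^+ k / k`!%:R)%:C.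
pose T' (t : R) := \sum_(k < K.+1) psi k.+1 0 * (t ^+ k / k`!%:R)%:C.
have T0 : T 0 = psi 0 0.
  rewrite /T big_ord_recl /= expr0 divr1 mulr1 big1 ?addr0// => i _.
  by rewrite expr0n /= mul0r rmorph0 mulr0.
have dT t : cderiv T t (T' t).
  pose D (k : nat) : R[i] :=
    psi k 0 * (if k is k'.+1 then (t ^+ k' / k'`!%:R)%:C else 0).
  have -> : T' t = \sum_(k < K.+2) D k by rewrite [RHS]big_ord_recl /D /= mulr0 add0r.
  apply: (@cderiv_sum _ (fun k t => psi k 0 * (t ^+ k / k`!%:R)%:C) t D) => k _.
  apply: cderivZ; case: k => [|k].
    by under eq_fun do rewrite expr0; exact: cderiv_cst.
  apply: cderiv_real => /=.
  have d1 : is_derive t 1 (fun x : R => x ^+ k.+1) (k.+1%:R * t ^+ k).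
    apply: DeriveDef; first exact: exprn_derivable.
    by rewrite exp_derive /GRing.scale /= mulr1.
  have d2 := is_deriveMf d1 (is_derive_cst ((k.+1`!%:R)^-1 : R) t 1).
  apply: (@is_derive_eqf (fun v => v ^+ k.+1 / k.+1`!%:R) _ _ _ d2).
  rewrite mulr0 add0r /cst factS natrM; field.
  have f0 : k`!%:R != 0 :> R by rewrite pnatr_eq0 -lt0n fact_gt0.
  have k0 : 1 + k%:R != 0 :> R by rewrite nat1r pnatr_eq0.
  by apply/andP; split; [exact: f0|exact: k0].
pose phi t := psi 0 t - T t.
have -> : psi 0 v - T v = phi v - phi 0 by rewrite /phi T0 subrr subr0.
rewrite exprS -mulrA.
apply: (@cmod_path_bound _ (fun t => psi 1 t - T' t)) => // t t01.
  apply: cderivD; first exact: pd.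
  by rewrite -mulN1r /phi; under eq_fun do rewrite -mulN1r; exact: cderivZ.
by apply: (IH (fun k => psi k.+1)) => // k x x01; exact: pd.
Qed.

(** Order 1 Taylor inequality for t -> exp(z t) on the unit segment; 4 is the [2 ^+ 2] of that
    inequality. *)
Lemma cmod_cexp_sub1 (z : R[i]) : cmod (cexp z - 1 - z) <= 4 * (cmod z ^+ 2 * expR (cmod z)).
Proof.
pose psi k (t : R) := z ^+ k * cexp (z * t%:C).
have := @cmod_taylor_bound 1 psi 1 (cmod z ^+ 2 * expR (cmod z)).
rewrite lexx ler01 => /(_ isT).
have -> : psi 0 1 - \sum_(k < 2) psi k 0 * (1 ^+ k / k`!%:R)%:C = cexp z - 1 - z.
  rewrite !big_ord_recr big_ord0 /= /psi !expr0 !mulr0 !cexp0 !fact0 factS fact0.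
  by rewrite !expr1n !divr1 !mulr1 !mul1r add0r opprD addrA.
have -> : 2 ^+ 2 = 4 :> R by rewrite expr2 -natrM.
apply=> [k t _|t /andP[t0 t1]].
  rewrite /psi exprSr -mulrA; apply: cderivZ; apply: cderiv_cexp.
  have dz := cderivZ z (cderiv_real (is_derive_id t (1 : R))).
  by rewrite mulr1 in dz.
rewrite /psi cmodM cmodX ler_wpM2l ?exprn_ge0 ?cmod_ge0// cmod_cexp ler_expR.
apply: le_trans (ler_norm _) _; apply: le_trans (Re_le_cmod _) _.
by rewrite cmodM cmodC_real ger0_norm// ler_piMr ?cmod_ge0.
Qed.

End RealPaths.

(** * Continuation of the Hurwitz zeta function *)

Section RealSeries.
Context {R : realType}.
Implicit Types (x a : R).

(** Powers of n + 1 are written [expR (b * lnS n)], so that comparing them is linear arithmetic on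
    exponents. *)
Definition lnS n : R := ln n.+1%:R.

Lemma lnS_ge0 n : 0 <= lnS n.
Proof. by rewrite ln_ge0// ler1n. Qed.

(** The series of (n + 1)^(-b) is dominated by a telescoping one: (n + 2)^(-b) is at most 1 / (b -
    1) times the drop of x^(1 - b) from n + 1 to n + 2. *)
Lemma zeta_real_bounded (b : R) : 1 < b ->
  exists B : R, forall N, \sum_(0 <= n < N) expR (- b * lnS n) <= B.
Proof.
move=> b1; have c0 : 0 < b - 1 by rewrite subr_gt0.
pose T n : R := expR (- (b - 1) * lnS n).
have step n : expR (- b * lnS n.+1) <= (b - 1)^-1 * (T n - T n.+1).
  rewrite ler_pdivlMl//.
  have -> : T n = T n.+1 * expR ((b - 1) * (lnS n.+1 - lnS n)).
    by rewrite /T -expRD; congr expR; ring.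
  have -> : expR (- b * lnS n.+1) = T n.+1 * (n.+2%:R)^-1.
    rewrite -[in RHS](@lnK _ n.+2%:R) ?posrE ?ltr0n// -expRN -expRD /lnS.
    by congr expR; ring.
  set E := expR (_ * (_ - _)); have -> : T n.+1 * E - T n.+1 = T n.+1 * (E - 1) by ring.
  rewrite mulrCA ler_wpM2l ?expR_ge0//.
  rewrite lerBrDl; apply: le_trans (expR_ge1Dx _).
  rewrite lerD2l; apply: ler_wpM2l; first exact: ltW.
  have n2 : (n.+2%:R : R) != 0 by rewrite pnatr_eq0.
  (* ln (1 - 1 / (n + 2)) <= - 1 / (n + 2) bounds the logarithmic increment from below. *)
  have := @le_ln1Dx R (- (n.+2%:R)^-1).
  rewrite ltrN2 invf_lt1 ?ltr0n// ltr1n => /(_ isT).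
  have -> : 1 + - (n.+2%:R)^-1 = n.+1%:R / n.+2%:R :> R.
    by move: n2; rewrite -(natr1 n.+1) => n2; field.
  by rewrite ln_div ?posrE ?ltr0n// lerNr opprB /lnS.
exists (1 + (b - 1)^-1) => -[|N].
  by rewrite big_geq// addr_ge0// invr_ge0 ltW.
rewrite big_nat_recl// /lnS ln1 mulr0 expR0 lerD2l.
apply: le_trans (_ : \sum_(0 <= i < N) (b - 1)^-1 * (T i - T i.+1) <= _).
  by apply: ler_sum => i _; exact: step.
rewrite -mulr_sumr; apply: ler_piMr; first by rewrite invr_ge0 ltW.
have -> : \sum_(0 <= i < N) (T i - T i.+1) = T 0 - T N.
  rewrite -[RHS]opprB -(telescope_sumr _ (leq0n N)) -sumrN.
  by apply: eq_bigr => i _; rewrite opprB.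
by rewrite /T /lnS ln1 mulr0 expR0 gerBl expR_ge0.
Qed.

Lemma sqr_le_expR (t : R) : 0 <= t -> t ^+ 2 <= 4 * expR t.
Proof.
move=> t0; have -> : expR t = expR (t / 2) ^+ 2.
  by rewrite -expRM_natr; congr expR; field.
have h : t / 2 <= expR (t / 2).
  by apply: le_trans (expR_ge1Dx _); rewrite lerDr.
have h0 : 0 <= t / 2 by rewrite divr_ge0.
have := ler_pM h0 h0 h h; rewrite -!expr2 => h2.
have -> : t ^+ 2 = 4 * (t / 2) ^+ 2 by field.
by rewrite ler_wpM2l.
Qed.

End RealSeries.

(** * Powers of n + q + u and their Taylor remainders in u *)

Section Hurwitz.
Context {R : realType}.
Variable q : R[i].
Hypothesis q_gt0 : 0 < complex.Re q.
Implicit Types (s h z : R[i]) (u : R) (n k K : nat).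

Definition shift_pt n u : R[i] := n%:R + q + u%:C.

Lemma Re_shift_pt_gt0 n u : 0 <= u -> 0 < complex.Re (shift_pt n u).
Proof.
move=> u0; rewrite !ReD Re_nat /=.
by rewrite ltr_wpDr// ltr_wpDl.
Qed.

Lemma shift_pt_neq0 n u : 0 <= u -> shift_pt n u != 0.
Proof.
by move=> /(Re_shift_pt_gt0 n); apply: contraTneq => ->; rewrite ltxx.
Qed.

Lemma shift_pt_log_bound : exists2 A : R, 2 <= A & forall n u, 0 <= u <= 1 ->
  `|ln (cmod (shift_pt n u)) - lnS n| <= A /\ cmod (clog (shift_pt n u)) <= lnS n + A.
Proof.
(* c (n + 1) <= |n + q + u| <= C (n + 1), so the logarithm differs from ln (n + 1) by at most |ln c|
   + |ln C|. *)
pose c : R := Num.min (complex.Re q) 1.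
pose C : R := cmod q + 2.
have c0 : 0 < c by rewrite lt_min q_gt0 ltr01.
have C0 : 0 < C by rewrite ltr_wpDl ?cmod_ge0.
pose A0 : R := `|ln c| + `|ln C|.
have A0_ge0 : 0 <= A0 by rewrite addr_ge0.
have key n u : 0 <= u <= 1 -> `|ln (cmod (shift_pt n u)) - lnS n| <= A0.
  move=> /andP[u0 u1].
  have y0 := Re_shift_pt_gt0 n u0.
  have m0 : 0 < cmod (shift_pt n u) by rewrite cmod_gt0 shift_pt_neq0.
  have n0 : 0 < n.+1%:R :> R by rewrite ltr0n.
  have n1 : 1 <= n.+1%:R :> R by rewrite ler1n.
  have lo : c * n.+1%:R <= cmod (shift_pt n u).
    apply: le_trans (Re_le_cmod _); apply: le_trans (ler_norm _).
    rewrite !ReD Re_nat /= -[n.+1]addn1 natrD mulrDr mulr1.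
    rewrite -[leLHS]addr0 lerD// lerD//; last by rewrite ge_min lexx.
    by rewrite ler_piMl// ge_min lexx orbT.
  have hi : cmod (shift_pt n u) <= C * n.+1%:R.
    apply: le_trans (cmodD _ _) _; rewrite cmodC_real ger0_norm//.
    apply: le_trans (_ : n%:R + cmod q + 1 <= _).
      by rewrite lerD//; apply: le_trans (cmodD _ _) _; rewrite cmod_nat.
    have -> : n%:R + cmod q + 1 = cmod q + n.+1%:R by rewrite -[n.+1]addn1 natrD; ring.
    by rewrite mulrDl lerD ?ler_peMr ?cmod_ge0// ler_peMl ?ler1n.
  have lo' : ln c + lnS n <= ln (cmod (shift_pt n u)).
    by rewrite -lnM ?posrE// ler_ln ?posrE ?mulr_gt0.
  have hi' : ln (cmod (shift_pt n u)) <= ln C + lnS n.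
    by rewrite -lnM ?posrE// ler_ln ?posrE ?mulr_gt0.
  have hc := ler_norm (- ln c); rewrite normrN in hc.
  have hC := ler_norm (ln C).
  have nc := normr_ge0 (ln c); have nC := normr_ge0 (ln C).
  by rewrite ler_norml /A0; apply/andP; split; lra.
(* The extra 2 covers the argument, by [carg_bound]. *)
exists (A0 + 2); first by rewrite lerDr.
move=> n u u01; split.
  by apply: le_trans (key _ _ u01) _; rewrite lerDl.
apply: le_trans (cmod_le_ReIm _) _; rewrite addrA lerD//; last first.
  by apply: carg_bound; apply: Re_shift_pt_gt0; case/andP: u01.
rewrite /= -[X in `|X|](subrK (lnS n)).
apply: le_trans (ler_normD _ _) _; rewrite (ger0_norm (lnS_ge0 n)) [leRHS]addrC.
by rewrite lerD2r; exact: key.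
Qed.

(** The exponent 2 A |s| splits into A |s| for replacing ln |n + q + u| by ln (n + 1), and A |s| for
    the argument, since [A] is at least 2. *)
Lemma cpow_shift_pt_bound (A : R) n u s : 2 <= A -> 0 <= u ->
  `|ln (cmod (shift_pt n u)) - lnS n| <= A ->
  cmod (cpow (shift_pt n u) s) <= expR (2 * A * cmod s) * expR (complex.Re s * lnS n).
Proof.
move=> A2 u0 lA; rewrite cmod_cpow -expRD ler_expR.
have -> : complex.Re s * ln (cmod (shift_pt n u)) - complex.Im s * carg (shift_pt n u) =
  (complex.Re s * (ln (cmod (shift_pt n u)) - lnS n) - complex.Im s * carg (shift_pt n u)) +
  complex.Re s * lnS n by ring.
rewrite lerD2r; apply: le_trans (ler_norm _) _.
apply: le_trans (ler_normB _ _) _; rewrite !normrM.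
have A0 : 0 <= A by apply: le_trans A2.
have -> : 2 * A * cmod s = cmod s * A + cmod s * A by ring.
apply: lerD; apply: ler_pM => //; rewrite ?Re_le_cmod ?Im_le_cmod//.
by apply: le_trans A2; apply: carg_bound; exact: Re_shift_pt_gt0.
Qed.

(* [falling k s = (1 - s) (- s) ... (2 - s - k)], so that [pow_deriv n s k u]
   below is the k-th derivative in u of [(n + q + u)^(1 - s)]; the prefix d
   stands for the derivative in s. *)
Fixpoint falling k s : R[i] := if k is k'.+1 then falling k' s * (1 - s - k'%:R) else 1.

Fixpoint dfalling k s : R[i] :=
  if k is k'.+1 then dfalling k' s * (1 - s - k'%:R) - falling k' s else 0.

Lemma falling_taylor k s : exists2 S : R, 0 <= S & forall h, cmod h <= 1 ->
  cmod (falling k (s + h) - falling k s - h * dfalling k s) <= S * cmod h ^+ 2.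
Proof.
elim: k => [|k [S S0 IH]].
  by exists 0 => // h _; rewrite /= mulr0 !subrr mul0r cmod0.
exists (cmod (dfalling k s) + S * (cmod (1 - s - k%:R) + 1)).
  by rewrite addr_ge0 ?cmod_ge0// mulr_ge0// addr_ge0 ?cmod_ge0.
move=> h h1 /=.
set f := falling k s; set f' := dfalling k s; set f1 := falling k (s + h).
(* The new linear factor has derivative -1 in s, so the product rule leaves the cross term - h * h *
   f' and the old remainder times a bounded factor. *)
have -> : f1 * (1 - (s + h) - k%:R) - f * (1 - s - k%:R) -
    h * (f' * (1 - s - k%:R) - f) =
  - (h * h * f') + (f1 - f - h * f') * ((1 - s - k%:R) - h) by ring.
apply: le_trans (cmodD _ _) _; rewrite cmodN !cmodM -expr2 mulrDl lerD//.
  by rewrite mulrC.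
rewrite mulrAC ler_pM ?cmod_ge0//; first exact: IH.
by apply: le_trans (cmodB _ _) _; rewrite lerD2l.
Qed.

Definition pow_deriv n s k u : R[i] := falling k s * cpow (shift_pt n u) (1 - s - k%:R).

Definition dpow_deriv n s k u : R[i] :=
  (dfalling k s - falling k s * clog (shift_pt n u)) * cpow (shift_pt n u) (1 - s - k%:R).

Lemma cderiv_shift_pt_cpow n a u : 0 <= u ->
  cderiv (fun t => cpow (shift_pt n t) a) u (a * cpow (shift_pt n u) (a - 1)).
Proof.
move=> u0; apply: cderiv_cpow.
by have := Re_shift_pt_gt0 n u0; rewrite /shift_pt ReD.
Qed.

Lemma cderiv_pow_deriv n s k u : 0 <= u -> cderiv (pow_deriv n s k) u (pow_deriv n s k.+1 u).
Proof.
move=> u0; have -> : pow_deriv n s k.+1 u =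
   falling k s * ((1 - s - k%:R) * cpow (shift_pt n u) (1 - s - k%:R - 1)).
  by rewrite /pow_deriv /= -mulrA -[k.+1]addn1 natrD opprD !addrA.
by apply: cderivZ; exact: cderiv_shift_pt_cpow.
Qed.

(** Derivatives in s and in u commute: the s-derivatives of [pow_deriv] form a chain of
    u-derivatives too, so the Taylor inequality in u applies to them. *)
Lemma cderiv_dpow_deriv n s k u : 0 <= u -> cderiv (dpow_deriv n s k) u (dpow_deriv n s k.+1 u).
Proof.
move=> u0; have x0 := shift_pt_neq0 n u0.
have dl : cderiv (fun t => clog (shift_pt n t)) u (shift_pt n u)^-1.
  by apply: cderiv_clog; have := Re_shift_pt_gt0 n u0; rewrite /shift_pt ReD.
have d1 := cderivD (cderiv_cst (dfalling k s) u) (cderivZ (- falling k s) dl).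
have := cderivM d1 (cderiv_shift_pt_cpow n (1 - s - k%:R) u0).
have -> : dpow_deriv n s k = fun t => (dfalling k s + - falling k s * clog (shift_pt n t)) *
    cpow (shift_pt n t) (1 - s - k%:R).
  by apply/funext => t; rewrite /dpow_deriv mulNr.
congr cderiv; rewrite /dpow_deriv /=.
have -> : 1 - s - k.+1%:R = 1 - s - k%:R - 1.
  by rewrite -[k.+1]addn1 natrD opprD !addrA.
rewrite (cpowD _ (1 - s - k%:R) (-1)) cpowN.
have -> : cpow (shift_pt n u) 1 = shift_pt n u by rewrite (cpow_nat 1 x0) expr1.
by field.
Qed.

(* Remainder of the Taylor expansion of [u |-> (n + q + u)^(1 - s)] at order K,
   taken at u = 1 *)
Definition taylor_rem K n s : R[i] :=
  pow_deriv n s 0 1 - \sum_(k < K.+1) pow_deriv n s k 0 * ((1 : R) ^+ k / k`!%:R)%:C.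

Definition dtaylor_rem K n s : R[i] :=
  dpow_deriv n s 0 1 - \sum_(k < K.+1) dpow_deriv n s k 0 * ((1 : R) ^+ k / k`!%:R)%:C.

Lemma taylor_rem_bound K n s (M : R) :
  (forall u, 0 <= u <= 1 -> cmod (pow_deriv n s K.+1 u) <= M) ->
  cmod (taylor_rem K n s) <= 2 ^+ K.+1 * M.
Proof.
move=> hM; apply: (@cmod_taylor_bound R K (pow_deriv n s)) => //.
  by rewrite ler01 lexx.
by move=> k t /andP[t0 _]; exact: cderiv_pow_deriv.
Qed.

Lemma dtaylor_rem_bound K n s (M : R) :
  (forall u, 0 <= u <= 1 -> cmod (dpow_deriv n s K.+1 u) <= M) ->
  cmod (dtaylor_rem K n s) <= 2 ^+ K.+1 * M.
Proof.
move=> hM; apply: (@cmod_taylor_bound R K (dpow_deriv n s)) => //.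
  by rewrite ler01 lexx.
by move=> k t /andP[t0 _]; exact: cderiv_dpow_deriv.
Qed.

(** The remainder is linear in the chain of derivatives, and the second order difference in s of
    [pow_deriv] is again such a chain. Its remainder is therefore controlled by its top member
    alone. *)
Lemma taylor_rem_taylor_bound K n s h (M : R) :
  (forall u, 0 <= u <= 1 ->
    cmod (pow_deriv n (s + h) K.+1 u - pow_deriv n s K.+1 u - h * dpow_deriv n s K.+1 u) <= M) ->
  cmod (taylor_rem K n (s + h) - taylor_rem K n s - h * dtaylor_rem K n s) <= 2 ^+ K.+1 * M.
Proof.
move=> hM.
pose psi k u := pow_deriv n (s + h) k u + (-1) * pow_deriv n s k u + (- h) * dpow_deriv n s k u.
have -> : taylor_rem K n (s + h) - taylor_rem K n s - h * dtaylor_rem K n s =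
  psi 0 1 - \sum_(k < K.+1) psi k 0 * ((1 : R) ^+ k / k`!%:R)%:C.
  rewrite /taylor_rem /dtaylor_rem; have -> : \sum_(k < K.+1) psi k 0 * (1 ^+ k / k`!%:R)%:C =
      \sum_(k < K.+1) pow_deriv n (s + h) k 0 * (1 ^+ k / k`!%:R)%:C +
      (-1) * (\sum_(k < K.+1) pow_deriv n s k 0 * (1 ^+ k / k`!%:R)%:C) +
      (- h) * (\sum_(k < K.+1) dpow_deriv n s k 0 * (1 ^+ k / k`!%:R)%:C).
    rewrite !mulr_sumr -!big_split /=; apply: eq_bigr => k _.
    by rewrite /psi; ring.
  by rewrite /psi; ring.
apply: cmod_taylor_bound => [|k t /andP[t0 _]|u u01].
- by rewrite ler01 lexx.
- rewrite /psi; apply: cderivD; last by apply: cderivZ; exact: cderiv_dpow_deriv.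
  by apply: cderivD; [|apply: cderivZ]; exact: cderiv_pow_deriv.
- by rewrite /psi mulN1r mulNr; exact: hM.
Qed.

End Hurwitz.

Section HurwitzContinuation.
Context {R : realType}.
Variable q : R[i].
Hypothesis q_gt0 : 0 < complex.Re q.
Implicit Types (s h z : R[i]) (u : R) (n k K : nat).
Local Notation shift_pt := (shift_pt q).
Local Notation pow_deriv := (pow_deriv q).
Local Notation dpow_deriv := (dpow_deriv q).
Local Notation taylor_rem := (taylor_rem q).
Local Notation dtaylor_rem := (dtaylor_rem q).

(** The (K + 1)-st derivative in u has size (n + 1)^(- b0) with b0 = Re s + K > 1. Varying s costs
    logarithms and small powers of n, which together stay below (n + 1)^(2 d) up to constants. *)
Lemma taylor_rem_summable K s : 1 < complex.Re s + K%:R ->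
  exists (M : nat -> R) (B r : R), [/\ 0 < r,
    forall N, \sum_(0 <= n < N) M n <= B,
    forall n, cmod (taylor_rem K n s) <= M n,
    forall n, cmod (dtaylor_rem K n s) <= M n &
    forall n h, cmod h < r ->
      cmod (taylor_rem K n (s + h) - taylor_rem K n s - h * dtaylor_rem K n s) <= M n * cmod h ^+ 2].
Proof.
move=> sK; have [A A2 logA] := shift_pt_log_bound q_gt0.
have A0 : 0 <= A by apply: le_trans A2.
(* Two factors (n + 1)^d will be spent, and 2 d is at most half of the margin b0 - 1. The same [d]
   serves as radius in h, whence d <= 1 for [falling_taylor]. *)
pose b0 := complex.Re s + K%:R; pose d : R := Num.min 1 ((b0 - 1) / 4).
have d0 : 0 < d by rewrite lt_min ltr01 divr_gt0// subr_gt0.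
have d1 : d <= 1 by rewrite ge_min lexx.
have dn0 : d != 0 by rewrite gt_eqF.
have b1 : 1 < b0 - 2 * d.
  have : d <= (b0 - 1) / 4 by rewrite ge_min lexx orbT.
  by rewrite ler_pdivlMr//; rewrite -/b0 in sK; lra.
have [B0 hB0] := zeta_real_bounded b1.
pose a : R[i] := 1 - s - K.+1%:R.
pose f := falling K.+1 s; pose f' := dfalling K.+1 s.
have [S S0 hS] := falling_taylor K.+1 s.
pose C0 := expR (2 * A * cmod a) * expR (2 * d * A).
(* [C1] adds up the coefficients of the three estimates below: for the second order remainder in s,
   for the term itself and for its s-derivative. *)
pose C1 := (S + (cmod f + cmod f') * (16 / d ^+ 2) + cmod f' / d)
           + (cmod f + (cmod f' + cmod f / d)).
pose M' n := C1 * (C0 * expR (- (b0 - 2 * d) * lnS n)).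
have C0_ge0 : 0 <= C0 by rewrite mulr_ge0 ?expR_ge0.
have P1 : 0 <= S + (cmod f + cmod f') * (16 / d ^+ 2) + cmod f' / d.
  by rewrite !addr_ge0 ?mulr_ge0 ?addr_ge0 ?cmod_ge0 ?invr_ge0 ?exprn_ge0// ltW.
have P2 : 0 <= cmod f' + cmod f / d.
  by rewrite addr_ge0 ?mulr_ge0 ?cmod_ge0 ?invr_ge0// ltW.
have P3 : 0 <= cmod f by rewrite cmod_ge0.
have C1_ge0 : 0 <= C1 := addr_ge0 P1 (addr_ge0 P3 P2).
(* [t] dominates the logarithm and [E] = exp(d t) is about (n + 1)^d. Powers of t are absorbed into
   E, and two factors E still leave a summable term. *)
have key n u : 0 <= u <= 1 -> exists t E : R, [/\ 1 <= E, 0 <= t /\ t <= E / d,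
    t ^+ 2 <= 4 / d ^+ 2 * E, expR (d * t) = E /\ cmod (clog (shift_pt n u)) <= t &
    cmod (cpow (shift_pt n u) a) * (E * E) <= C0 * expR (- (b0 - 2 * d) * lnS n)].
  move=> u01; have [lA lt] := logA n u u01; have u0 : 0 <= u by case/andP: u01.
  have t0 : 0 <= lnS n + A by rewrite addr_ge0// lnS_ge0.
  exists (lnS n + A), (expR (d * (lnS n + A))).
  have dt0 : 0 <= d * (lnS n + A) by rewrite mulr_ge0// ltW.
  split => //.
  - by rewrite -expR0 ler_expR.
  - split => //; rewrite ler_pdivlMr// mulrC.
    by apply: le_trans (expR_ge1Dx _); rewrite lerDr.
  - have := sqr_le_expR dt0; rewrite exprMn => h.
    by rewrite mulrAC ler_pdivlMr ?exprn_gt0// mulrC.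
  apply: le_trans (ler_wpM2r _ (cpow_shift_pt_bound q_gt0 a A2 u0 lA)) _.
    by rewrite mulr_ge0 ?expR_ge0.
  rewrite /C0 -!expRD ler_expR /a !(ReD, ReN) Re_nat /= -[K.+1]addn1 natrD /b0.
  by rewrite le_eqVlt; apply/orP; left; apply/eqP; ring.
have le_M' n (x y c E : R) : 0 <= c -> c <= C1 -> 0 <= x ->
    x * E <= C0 * expR (- (b0 - 2 * d) * lnS n) -> y <= c * (x * E) -> y <= M' n.
  move=> c0 cC x0 xE yc; apply: le_trans yc _; rewrite /M'.
  apply: le_trans (ler_wpM2l c0 xE) _; apply: ler_wpM2r cC.
  by rewrite mulr_ge0 ?expR_ge0.
exists (fun n => 2 ^+ K.+1 * M' n), (2 ^+ K.+1 * (C1 * (C0 * B0))), d; split => //.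
- move=> N; rewrite -mulr_sumr; apply: ler_wpM2l; first exact: exprn_ge0.
  rewrite -mulr_sumr; apply: ler_wpM2l => //.
  by rewrite -mulr_sumr; apply: ler_wpM2l.
- move=> n; apply: taylor_rem_bound => // u u01.
  have [t [E [E1 _ _ _ hE]]] := key n u u01.
  apply: (le_M' n _ _ (cmod f) _ _ _ (cmod_ge0 _) hE) => //.
    by rewrite /C1 -[leLHS]add0r lerD// lerDl.
  rewrite /pow_deriv cmodM -/a -/f ler_wpM2l// ler_peMr ?cmod_ge0//.
  by rewrite mulr_ege1.
- move=> n; apply: dtaylor_rem_bound => // u u01.
  have [t [E [E1 [t0 tE] _ [_ lt] hE]]] := key n u u01.
  apply: (le_M' n _ _ (cmod f' + cmod f / d) _ _ _ (cmod_ge0 _) hE) => //.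
    by rewrite /C1 -[leLHS]add0r lerD// lerDr.
  rewrite /dpow_deriv cmodM -/a -/f -/f'.
  have E0 : 0 <= E by apply: le_trans E1.
  apply: le_trans (_ : (cmod f' * E + cmod f * (E / d)) * cmod (cpow (shift_pt n u) a) <= _).
    apply: ler_wpM2r; first exact: cmod_ge0.
    apply: le_trans (cmodB _ _) _; rewrite cmodM lerD//.
      by rewrite ler_peMr ?cmod_ge0.
    by rewrite ler_wpM2l ?cmod_ge0//; apply: le_trans lt tE.
  have -> : (cmod f' * E + cmod f * (E / d)) * cmod (cpow (shift_pt n u) a) =
    (cmod f' + cmod f / d) * (cmod (cpow (shift_pt n u) a) * E) by field.
  by rewrite ler_wpM2l// ler_wpM2l ?cmod_ge0// ler_peMr.
- move=> n h hd; rewrite -mulrA; apply: taylor_rem_taylor_bound => // u u01.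
  have [t [E [E1 [t0 tE] t2E [Edef lt] hE]]] := key n u u01.
  have E0 : 0 <= E by apply: le_trans E1.
  set G := cpow (shift_pt n u) a in hE *; set l := clog (shift_pt n u) in lt *.
  have h0 : 0 <= cmod h := cmod_ge0 h.
  have h1 : cmod h <= 1 by rewrite (le_trans (ltW hd)).
  (* [sg] and [rho] are the second order remainders of the polynomial factor and of the exponential;
     [e1] is the quotient of the powers at s + h and at s. *)
  pose sg := falling K.+1 (s + h) - f - h * f'.
  pose e1 := cexp (- (h * l)); pose rho := e1 - 1 - (- (h * l)).
  have GE : cpow (shift_pt n u) (1 - (s + h) - K.+1%:R) = G * e1.
    by rewrite /G /cpow -/l /e1 -cexpD; congr cexp; rewrite /a; ring.
  have hl : cmod (- (h * l)) <= d * t.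
    by rewrite cmodN cmodM ler_pM ?cmod_ge0// ltW.
  have exE : expR (cmod (- (h * l))) <= E by rewrite -Edef ler_expR.
  have e1E : cmod e1 <= E.
    rewrite /e1 cmod_cexp; apply: le_trans exE; rewrite ler_expR.
    exact: le_trans (ler_norm _) (Re_le_cmod _).
  have rhoE : cmod rho <= cmod h ^+ 2 * (16 / d ^+ 2) * (E * E).
    apply: le_trans (cmod_cexp_sub1 _) _.
    (* 16 = 4 * 4: one 4 from [cmod_cexp_sub1], the other from bounding t ^+ 2 by E. *)
    have -> : cmod h ^+ 2 * (16 / d ^+ 2) * (E * E) =
      4 * ((cmod h ^+ 2 * (4 / d ^+ 2 * E)) * E) by field.
    apply: ler_wpM2l => //; apply: ler_pM => //; rewrite ?exprn_ge0 ?cmod_ge0 ?expR_ge0//.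
    rewrite cmodN cmodM exprMn; apply: ler_wpM2l; first exact: exprn_ge0.
    by apply: le_trans t2E; rewrite lerXn2r ?nnegrE ?cmod_ge0.
  have EE : E <= E * E by rewrite ler_peMr.
  have -> : pow_deriv n (s + h) K.+1 u - pow_deriv n s K.+1 u - h * dpow_deriv n s K.+1 u =
      G * (sg * e1 + (f + h * f') * rho - h * h * (f' * l)).
    by rewrite /pow_deriv /dpow_deriv GE -/a -/G -/l -/f -/f' /rho /sg; ring.
  have -> : M' n * cmod h ^+ 2 = cmod h ^+ 2 * M' n by rewrite mulrC.
  have bnd : cmod (sg * e1 + (f + h * f') * rho - h * h * (f' * l)) <=
     cmod h ^+ 2 * ((S + (cmod f + cmod f') * (16 / d ^+ 2) + cmod f' / d) * (E * E)).
    have split3 (x y z w v : R) : v * ((x + y + z) * w) = v * (x * w) + v * (y * w) + v * (z * w).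
      by ring.
    rewrite split3; apply: le_trans (cmodB _ _) _; apply: lerD.
      apply: le_trans (cmodD _ _) _; apply: lerD.
        rewrite cmodM mulrA; apply: ler_pM; rewrite ?cmod_ge0//.
          by rewrite mulrC; exact: hS.
        exact: le_trans EE.
      rewrite cmodM.
      have -> : cmod h ^+ 2 * ((cmod f + cmod f') * (16 / d ^+ 2) * (E * E)) =
        (cmod f + cmod f') * (cmod h ^+ 2 * (16 / d ^+ 2) * (E * E)) by ring.
      apply: ler_pM; rewrite ?cmod_ge0//.
      apply: le_trans (cmodD _ _) _; rewrite lerD2l cmodM.
      by rewrite ler_piMl ?cmod_ge0.
    rewrite !cmodM -expr2; apply: ler_wpM2l; first exact: exprn_ge0.
    rewrite -mulrA; apply: ler_wpM2l; first exact: cmod_ge0.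
    apply: le_trans lt _; apply: le_trans tE _; rewrite mulrC.
    by apply: ler_wpM2l EE; rewrite invr_ge0 ltW.
  rewrite cmodM; apply: le_trans (ler_wpM2l (cmod_ge0 G) bnd) _.
  rewrite mulrCA; apply: ler_wpM2l; first exact: exprn_ge0.
  apply: (le_M' n (cmod G) _ (S + (cmod f + cmod f') * (16 / d ^+ 2) + cmod f' / d)
    (E * E)) => //; rewrite ?cmod_ge0//.
    by rewrite /C1 lerDl addr_ge0.
  by rewrite mulrCA.
Qed.

End HurwitzContinuation.

(** * The recursion from one half-plane to the next *)

Section HurwitzRecursion.
Context {R : realType}.
Variable q : R[i].
Hypothesis q_gt0 : 0 < complex.Re q.
Implicit Types (s h z : R[i]) (u : R) (n k K : nat).
Local Notation shift_pt := (shift_pt q).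
Local Notation pow_deriv := (pow_deriv q).
Local Notation taylor_rem := (taylor_rem q).

Definition csum_value (u : nat -> R[i]) : R[i] := limn (series (u : nat -> Cplx R)).

Lemma csum_valueE (u : nat -> R[i]) (l : R[i]) : csums u l -> csum_value u = l.
Proof. by move=> ul; apply: limn_ccvg. Qed.

Lemma shift_pt0 n : shift_pt n 0 = n%:R + q. Proof. by rewrite /shift_pt addr0. Qed.

Lemma shift_pt1 n : shift_pt n 1 = n.+1%:R + q.
Proof. by rewrite /shift_pt -[n.+1]addn1 natrD addrAC. Qed.

Lemma hurwitz_abs_bound s : 1 < complex.Re s ->
  exists B : R, forall N, \sum_(0 <= n < N) cmod (cpow (n%:R + q) (- s)) <= B.
Proof.
move=> s1; have [A A2 logA] := shift_pt_log_bound q_gt0.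
have [B hB] := zeta_real_bounded s1.
exists (expR (2 * A * cmod (- s)) * B) => N.
apply: le_trans (_ : \sum_(0 <= n < N)
    expR (2 * A * cmod (- s)) * expR (- complex.Re s * lnS n) <= _).
  apply: ler_sum => n _; rewrite -shift_pt0 -ReN; apply: cpow_shift_pt_bound => //.
  by have [] := logA n 0; rewrite ?lexx ?ler01.
by rewrite -mulr_sumr ler_wpM2l// expR_ge0.
Qed.

Lemma hurwitz_csums s : 1 < complex.Re s ->
  csums (fun n => cpow (n%:R + q) (- s)) (hurwitz_series s q).
Proof.
move=> /hurwitz_abs_bound[B hB].
have [l ul _] := abs_csums hB.
by rewrite (_ : hurwitz_series s q = l)//; exact: csum_valueE.
Qed.

(** Removes the far end of the telescoping sum in [hurwitz_step1], where it is used at s - 1. *)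
Lemma hurwitz_term_cvg0 s : 0 < complex.Re s -> ccvg (fun n => cpow (n%:R + q) (- s)) 0.
Proof.
move=> s0; have [A A2 logA] := shift_pt_log_bound q_gt0.
move=> e e0.
pose C := expR (2 * A * cmod (- s)).
have C0 : 0 < C by rewrite expR_gt0.
(* [v] solves C exp(- Re s v) = e / 2; from [N] on, ln (n + 1) is at least [v]. *)
pose v := ln (e / (2 * C)) / - complex.Re s.
pose N := Num.bound (expR v).
exists N => n Nn; rewrite sub0r cmodN -shift_pt0.
have [|lA _] := logA n 0; first by rewrite lexx ler01.
apply: le_lt_trans (cpow_shift_pt_bound q_gt0 (- s) A2 (lexx 0) lA) _.
have nv : v <= lnS n.
  rewrite -[v]expRK /lnS ler_ln ?posrE ?expR_gt0 ?ltr0n//.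
  have := @archi_boundP R _ (expR_ge0 v); rewrite -/N => /ltW h.
  by apply: le_trans h _; rewrite ler_nat (leq_trans Nn).
rewrite -/C ReN; apply: le_lt_trans (_ : C * (e / (2 * C)) < e).
  apply: ler_wpM2l; first exact: ltW.
  rewrite -[leRHS](@lnK _ (e / (2 * C))) ?posrE ?divr_gt0 ?mulr_gt0//.
  rewrite ler_expR; move: nv; rewrite /v ler_ndivrMr ?oppr_lt0//.
  by rewrite mulrC.
have -> : C * (e / (2 * C)) = e / 2 by field; rewrite gt_eqF.
by rewrite ltr_pdivrMr// mulr_natr mulr2n ltrDl.
Qed.

Definition sum_taylor_rem K s : R[i] := csum_value (fun n => taylor_rem K n s).

Lemma sum_taylor_rem_csums K s : 1 < complex.Re s + K%:R ->
  csums (fun n => taylor_rem K n s) (sum_taylor_rem K s).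
Proof.
move=> /(taylor_rem_summable q_gt0)[M [B [r [_ MB bM _ _]]]].
have [|l ul _] := @abs_csums _ (fun n => taylor_rem K n s) B.
  by move=> N; apply: le_trans (MB N); exact: ler_sum.
by rewrite /sum_taylor_rem (csum_valueE ul).
Qed.

Lemma differentiable_sum_taylor_rem K s : 1 < complex.Re s + K%:R ->
  differentiable (sum_taylor_rem K : Cplx R -> Cplx R) (s : Cplx R).
Proof.
move=> sK; have [M [B [r [r0 MB bM bdM bh]]]] := taylor_rem_summable q_gt0 sK.
pose e : R := complex.Re s + K%:R - 1.
have e0 : 0 < e by rewrite subr_gt0.
apply: (@differentiable_csums R (taylor_rem K) (dtaylor_rem q K ^~ s) _ s M B (Num.min r e)).
- by rewrite lt_min r0.
- exact: MB.
- exact: bdM.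
- by move=> n h; rewrite lt_min => /andP[hr _]; exact: bh.
move=> h; rewrite lt_min => /andP[_ he]; apply: sum_taylor_rem_csums.
have := Re_le_cmod h; have := ler_norm (- complex.Re h); rewrite normrN ReD.
by rewrite /e in he => *; lra.
Qed.

(** The Taylor term of order K + 1 at n is a multiple of the n-th Hurwitz term at s + K; summed over
    n, a change of order becomes a zeta value. *)
Lemma taylor_rem_recr K n s : taylor_rem K n s = taylor_rem K.+1 n s +
  (falling K.+1 s / K.+1`!%:R) * cpow (n%:R + q) (- (s + K%:R)).
Proof.
have -> : cpow (n%:R + q) (- (s + K%:R)) = cpow (shift_pt n 0) (1 - s - K.+1%:R).
  by rewrite shift_pt0; congr cpow; rewrite -[K.+1]addn1 natrD; ring.
have hp : pow_deriv n s K.+1 0 = falling K.+1 s * cpow (shift_pt n 0) (1 - s - K.+1%:R) by [].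
set F := falling K.+1 s in hp *; set P := cpow _ _ in hp *.
rewrite /taylor_rem [in RHS]big_ord_recr /= hp.
have -> : ((1 : R) ^+ K.+1 / K.+1`!%:R)%:C = (K.+1`!%:R)^-1 :> R[i].
  by rewrite expr1n div1r fmorphV rmorph_nat.
by ring.
Qed.

Lemma sum_taylor_rem_succ K s : 1 < complex.Re s + K%:R ->
  sum_taylor_rem K s = sum_taylor_rem K.+1 s +
    (falling K.+1 s / K.+1`!%:R) * hurwitz_series (s + K%:R) q.
Proof.
move=> sK; apply: ccvg_unique (sum_taylor_rem_csums sK) _.
have sK1 : 1 < complex.Re s + K.+1%:R.
  by rewrite (lt_le_trans sK)// lerD2l ler_nat.
have sK' : 1 < complex.Re (s + K%:R) by rewrite ReD Re_nat.
apply: csums_ext (csumsD (sum_taylor_rem_csums sK1) (csumsZ _ (hurwitz_csums sK'))) => n.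
by rewrite -taylor_rem_recr.
Qed.

(** The order 1 expansion summed over n has two values: termwise it gives the remainder plus (1 - s)
    zeta, by telescoping it gives - q^(1 - s). *)
Lemma hurwitz_step1 s : 1 < complex.Re s ->
  (s - 1) * hurwitz_series s q = cpow q (1 - s) + sum_taylor_rem 1 s.
Proof.
move=> s1.
have s2 : 1 < complex.Re s + 1%:R by rewrite ltr_wpDr.
have c1 := csumsD (sum_taylor_rem_csums s2) (csumsZ (1 - s) (hurwitz_csums s1)).
have c2 : csums (fun n => taylor_rem 1 n s + (1 - s) * cpow (n%:R + q) (- s)) (- cpow q (1 - s)).
  have s0 : 0 < complex.Re (s - 1) by rewrite ReD ReN /= subr_gt0.
  have := ccvgB (hurwitz_term_cvg0 s0) (ccvg_cst (cpow q (1 - s))).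
  rewrite sub0r; apply: ccvg_ext => N.
  have -> : cpow q (1 - s) = cpow (0%:R + q) (- (s - 1)) by rewrite add0r opprB.
  rewrite -(@telescope_sumr _ 0 N (fun n => cpow (n%:R + q) (- (s - 1))))//.
  apply: eq_bigr => n _.
  rewrite /taylor_rem !big_ord_recr big_ord0 /= /pow_deriv /= shift_pt0 shift_pt1 !fact0 factS fact0.
  rewrite !expr0 expr1 !divr1 !mul1r !mulr1 add0r opprB !subr0.
  have -> : 1 - s - 1%:R = - s by ring.
  by ring.
have := ccvg_unique c1 c2 => h.
have -> : (s - 1) * hurwitz_series s q =
  sum_taylor_rem 1 s - (sum_taylor_rem 1 s + (1 - s) * hurwitz_series s q) by ring.
by rewrite h; ring.
Qed.

(* [hurwitz_strip K s] is [(s - 1) zeta(s, q)], continued to [1 - K < Re s]: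
   summing the Taylor expansions of [(n + q + u)^(1 - s)] over n telescopes, and
   expresses the value at s through those at s + 1, ..., s + K - 1. *)
Fixpoint hurwitz_strip K s : R[i] :=
  if K is K'.+1 then
    cpow q (1 - s) - \sum_(j < K') falling j.+1 s / j.+2`!%:R * hurwitz_strip K' (s + j.+1%:R)
    + sum_taylor_rem K s
  else (s - 1) * hurwitz_series s q.

Lemma hurwitz_stripS K s : hurwitz_strip K.+1 s =
  cpow q (1 - s) - \sum_(j < K) falling j.+1 s / j.+2`!%:R * hurwitz_strip K (s + j.+1%:R)
  + sum_taylor_rem K.+1 s.
Proof. by []. Qed.

Lemma fallingS k s : falling k.+1 s = falling k s * (1 - s - k%:R).
Proof. by []. Qed.

(** Both claims go through one induction. Passing from strip K + 1 to K + 2 leaves the terms j < K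
    unchanged by the first claim, since their arguments lie further right, and adds the term j = K
    at s + K + 1, where the second claim gives the series itself. *)
Lemma hurwitz_strip_succ K :
  (forall s, 1 < complex.Re s + K%:R -> hurwitz_strip K.+1 s = hurwitz_strip K s) /\
  (forall s, 1 < complex.Re s -> hurwitz_strip K.+1 s = (s - 1) * hurwitz_series s q).
Proof.
elim: K => [|K [IH1 IH2]].
  have h s : 1 < complex.Re s -> hurwitz_strip 1 s = (s - 1) * hurwitz_series s q.
    by move=> s1; rewrite hurwitz_step1//= big_ord0 subr0.
  by split=> // s; rewrite addr0; exact: h.
have step s : 1 < complex.Re s + K.+1%:R -> hurwitz_strip K.+2 s = hurwitz_strip K.+1 s.
  move=> sK; rewrite [LHS]hurwitz_stripS [RHS]hurwitz_stripS.
  have -> : \sum_(j < K.+1) falling j.+1 s / j.+2`!%:R * hurwitz_strip K.+1 (s + j.+1%:R) =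
    \sum_(j < K) falling j.+1 s / j.+2`!%:R * hurwitz_strip K.+1 (s + j.+1%:R) +
    falling K.+1 s / K.+2`!%:R * hurwitz_strip K.+1 (s + K.+1%:R) by rewrite big_ord_recr.
  have -> : \sum_(j < K) falling j.+1 s / j.+2`!%:R * hurwitz_strip K.+1 (s + j.+1%:R) =
            \sum_(j < K) falling j.+1 s / j.+2`!%:R * hurwitz_strip K (s + j.+1%:R).
    apply: eq_bigr => j _; congr (_ * _); apply: IH1.
    rewrite ReD Re_nat -addrA (addrC j.+1%:R) addrA.
    rewrite -[K.+1]addn1 natrD addrA in sK; apply: (lt_le_trans sK).
    by rewrite lerD2l ler_nat.
  have -> : hurwitz_strip K.+1 (s + K.+1%:R) =
      (s + K.+1%:R - 1) * hurwitz_series (s + K.+1%:R) q.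
    by apply: IH2; rewrite ReD Re_nat.
  (* 1 - s - (K + 1) = - ((s + K + 1) - 1): the added term cancels the change of the remainder. *)
  rewrite (sum_taylor_rem_succ sK) (fallingS K.+1). ring.
split=> // s s1; rewrite step ?IH2//.
by rewrite ltr_wpDr.
Qed.

Lemma hurwitz_strip_addr K m s : 1 < complex.Re s + K%:R ->
  hurwitz_strip (K + m) s = hurwitz_strip K s.
Proof.
move=> sK; elim: m => [|m IH]; first by rewrite addn0.
rewrite addnS (hurwitz_strip_succ (K + m)).1// natrD addrA.
by rewrite ltr_wpDr.
Qed.

Lemma hurwitz_strip_indep K K' s : 1 < complex.Re s + K%:R -> 1 < complex.Re s + K'%:R ->
  hurwitz_strip K s = hurwitz_strip K' s.
Proof.
move=> h h'; case: (leqP K K') => [/subnKC|/ltnW/subnKC] <-.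
  by rewrite hurwitz_strip_addr.
by rewrite hurwitz_strip_addr.
Qed.

End HurwitzRecursion.

(** * Holomorphy of the continued function *)

Section Holomorphy.
Context {R : realType} {V : normedModType R[i]}.
Implicit Types (f g : V -> Cplx R) (x : V).

Lemma cdiff_cst (c : R[i]) x : differentiable ((fun=> c) : V -> Cplx R) x.
Proof. exact: differentiable_cst. Qed.

Lemma cdiffD f g x : differentiable f x -> differentiable g x ->
  differentiable ((fun y => (f y : R[i]) + (g y : R[i])) : V -> Cplx R) x.
Proof. exact: differentiableD. Qed.

Lemma cdiffM f g x : differentiable f x -> differentiable g x ->
  differentiable ((fun y => (f y : R[i]) * (g y : R[i])) : V -> Cplx R) x.
Proof. exact: differentiableM. Qed.

Lemma cdiff_sum (I : Type) (s : seq I) (f : I -> V -> R[i]) x :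
  (forall i, differentiable (f i : V -> Cplx R) x) ->
  differentiable ((fun y => \sum_(i <- s) f i y) : V -> Cplx R) x.
Proof.
move=> df; elim: s => [|i s IH].
  by under eq_fun do rewrite big_nil; exact: cdiff_cst.
by under eq_fun do rewrite big_cons; exact: cdiffD.
Qed.

Lemma cdiff_comp (F : Cplx R -> Cplx R) f x :
  differentiable f x -> differentiable F (f x) ->
  differentiable ((fun y => F (f y)) : V -> Cplx R) x.
Proof. by move=> df dF; exact: (differentiable_comp df dF). Qed.

End Holomorphy.

Section EntireFunctions.
Context {R : realType}.
Implicit Types (s c z : R[i]).

Lemma differentiable_cexp z : differentiable (@cexp R : Cplx R -> Cplx R) (z : Cplx R).
Proof.
apply: (@differentiable_cplx R _ z (cexp z) (cmod (cexp z) * (4 * expR 1)) 1) => // h h1.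
have -> : cexp (z + h) - cexp z - h * cexp z = cexp z * (cexp h - 1 - h).
  by rewrite cexpD; ring.
rewrite cmodM -mulrA; apply: ler_wpM2l; first exact: cmod_ge0.
apply: le_trans (cmod_cexp_sub1 h) _; rewrite -mulrA; apply: ler_wpM2l => //.
by rewrite mulrC ler_wpM2r ?sqr_ge0// ler_expR ltW.
Qed.

Lemma cdiff_id z : differentiable ((fun s => s) : Cplx R -> Cplx R) (z : Cplx R).
Proof. by []. Qed.

Lemma cdiff_cpow {V : normedModType R[i]} (c : R[i]) (f : V -> Cplx R) (x : V) :
  differentiable f x -> differentiable ((fun y => cpow c (f y)) : V -> Cplx R) x.
Proof.
move=> df; have df1 := cdiffM df (cdiff_cst (clog c) x).
exact: (cdiff_comp df1 (differentiable_cexp _)).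
Qed.

Lemma cdiff_falling {V : normedModType R[i]} k (f : V -> Cplx R) (x : V) :
  differentiable f x -> differentiable ((fun y => falling k (f y)) : V -> Cplx R) x.
Proof.
move=> df; elim: k => [|k IH]; first exact: cdiff_cst.
have dB := cdiffD (cdiff_cst (1 - k%:R) x) (cdiffM (cdiff_cst (-1) x) df).
have -> : (fun y => falling k.+1 (f y)) =
    fun y => falling k (f y) * ((1 - k%:R) + (-1) * (f y : R[i])).
  by apply/funext => y; rewrite fallingS; ring.
exact: (cdiffM IH dB).
Qed.

Variable q : R[i].
Hypothesis q_gt0 : 0 < complex.Re q.

(** Starts at strip 1: there the formula involves no series but that of the remainders, already
    known to be differentiable. *)
Lemma differentiable_hurwitz_strip K s : 1 < complex.Re s + K.+1%:R ->
  differentiable (hurwitz_strip q K.+1 : Cplx R -> Cplx R) (s : Cplx R).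
Proof.
elim: K s => [|K IH] s sK.
  have d1 := cdiff_cpow q (cdiffD (cdiff_cst 1 _) (cdiffM (cdiff_cst (-1) _) (cdiff_id s))).
  have -> : hurwitz_strip q 1 = fun s => cpow q (1 + (-1) * s) + sum_taylor_rem q 1 s.
    by apply/funext => t; rewrite hurwitz_stripS big_ord0 subr0 mulN1r.
  exact: (cdiffD d1 (differentiable_sum_taylor_rem q_gt0 sK)).
have -> : hurwitz_strip q K.+2 = fun s => (cpow q (1 + (-1) * s) +
    (-1) * \sum_(j < K.+1) falling j.+1 s *
      ((j.+2`!%:R)^-1 * hurwitz_strip q K.+1 (s + j.+1%:R))) +
    sum_taylor_rem q K.+2 s.
  apply/funext => t; rewrite hurwitz_stripS !mulN1r; congr (_ - _ + _).
  by apply: eq_bigr => j _; rewrite -mulrA.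
have d1 := cdiff_cpow q (cdiffD (cdiff_cst 1 _) (cdiffM (cdiff_cst (-1) _) (cdiff_id s))).
apply: (cdiffD _ (differentiable_sum_taylor_rem q_gt0 sK)).
apply: (cdiffD d1); apply: (cdiffM (cdiff_cst (-1) _)).
apply: cdiff_sum => j; apply: (cdiffM (cdiff_falling j.+1 (cdiff_id s))).
have sj : 1 < complex.Re (s + j.+1%:R) + K.+1%:R.
  rewrite ReD Re_nat; rewrite -[K.+2]addn1 natrD addrA in sK.
  by have : 1 <= j.+1%:R :> R by [rewrite ler1n]; lra.
exact: (cdiffM (cdiff_cst _ _)
  (cdiff_comp (cdiffD (cdiff_id s) (cdiff_cst (j.+1%:R) _)) (IH _ sj))).
Qed.

End EntireFunctions.

Section HurwitzExists.
Context {R : realType}.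
Implicit Types (s c z : R[i]).

Lemma nbhs_cplxP (z : Cplx R) (P : set (Cplx R)) :
  nbhs z P <-> exists2 e : R, 0 < e & forall w : R[i], cmod (w - z) < e -> P w.
Proof.
split=> [/(@nbhs_normP _ (Cplx R) z P)[e /= /gt0_complexE[-> e0] h]|[e e0 h]].
  exists (complex.Re e) => // w wz; apply: h => /=.
  by rewrite normC_cmod ltcR -cmodN opprB.
apply/(@nbhs_normP _ (Cplx R) z P); exists e%:C => /=; first by rewrite ltcR.
move=> w /=; rewrite normC_cmod ltcR -cmodN opprB; exact: h.
Qed.

Lemma open_Re_gt (a : R) : open [set s : Cplx R | a < complex.Re s].
Proof.
rewrite openE => s /= sa; apply/nbhs_cplxP.
exists (complex.Re s - a) => [|w wz]; first by rewrite subr_gt0.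
have := Re_le_cmod (w - s); have := ler_norm (- complex.Re (w - s)).
by rewrite normrN ReD ReN /=; lra.
Qed.

Lemma near_eq_cdiff (f g : Cplx R -> Cplx R) (z : Cplx R) :
  (\near z, f z = g z) -> differentiable f z -> differentiable g z.
Proof.
by move=> fg /derivable1_diffP df; apply/derivable1_diffP; exact: near_eq_derivable df.
Qed.

Variable q : R[i].
Hypothesis q_gt0 : 0 < complex.Re q.

Definition strip_index s : nat := Num.bound `|1 - complex.Re s|.

Lemma strip_indexP s : 1 < complex.Re s + (strip_index s).+1%:R.
Proof.
have := @archi_boundP R _ (normr_ge0 (1 - complex.Re s)); rewrite -/(strip_index s) => h.
have := ler_norm (1 - complex.Re s); rewrite -[(strip_index s).+1]addn1 natrD.
by lra.
Qed.

Definition hurwitz_cont s : R[i] := hurwitz_strip q (strip_index s).+1 s / (s - 1).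

(** The index chosen in [hurwitz_cont] jumps with [s]; on each open strip it can be frozen, and
    differentiability is then that of a single [hurwitz_strip]. *)
Lemma hurwitz_contE K s : 1 < complex.Re s + K.+1%:R ->
  hurwitz_cont s = hurwitz_strip q K.+1 s / (s - 1).
Proof. by move=> sK; rewrite /hurwitz_cont (hurwitz_strip_indep q_gt0 (strip_indexP s) sK). Qed.

Lemma open_strip K : open [set s : Cplx R | 1 < complex.Re s + K.+1%:R].
Proof.
have := @open_Re_gt (1 - K.+1%:R).
congr open; apply/seteqP; split => s /=; rewrite ltrBlDr//.
Qed.

Lemma is_hurwitz_cont : is_hurwitz q hurwitz_cont.
Proof.
split.
- move=> s s1; have s11 : (s : R[i]) - 1 != 0.
    apply: contraTneq s1 => /eqP; rewrite subr_eq0 => /eqP ->.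
    by rewrite ltxx.
  rewrite (@hurwitz_contE 0); last by rewrite ltr_wpDr.
  by rewrite (hurwitz_strip_succ q_gt0 0).2// mulrC mulKf.
- move=> z /= z1.
  have z11 : (z : R[i]) - 1 != 0 by rewrite subr_eq0.
  apply: (@near_eq_cdiff (fun s => hurwitz_strip q (strip_index z).+1 s * (s + (-1))^-1)).
    near=> s; rewrite (@hurwitz_contE (strip_index z))//.
    by near: s; apply: open_nbhs_nbhs; split; [exact: open_strip|exact: strip_indexP].
  apply: (cdiffM (differentiable_hurwitz_strip q_gt0 (strip_indexP z))).
  exact: (differentiableV (cdiffD (cdiff_id z) (cdiff_cst (-1) _)) z11).
- move=> z0; exists [set s | 1 < complex.Re s + (strip_index z0).+1%:R].
  exists (hurwitz_strip q (strip_index z0).+1), (fun s => (s : R[i]) + (-1)); split.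
  + exact: open_strip.
  + exact: strip_indexP.
  + split=> s /= sK; first exact: differentiable_hurwitz_strip.
    exact: (cdiffD (cdiff_id s) (cdiff_cst (-1) _)).
  (* An affine function of slope 1 cannot vanish both at z and at z + e / 2. *)
  + move=> z _ /nbhs_cplxP[e e0 h].
    have hz0 : (z : R[i]) - 1 = 0 by apply: h; rewrite subrr cmod0.
    have hze : (z + (e / 2)%:C : R[i]) - 1 = 0.
      apply: h; rewrite addrAC subrr add0r cmodC_real gtr0_norm ?divr_gt0//.
      by rewrite ltr_pdivrMr// mulr_natr mulr2n ltrDl.
    have : complex.Re ((z + (e / 2)%:C : R[i]) - 1 - (z - 1)) = 0.
      by rewrite hze hz0 subr0.
    rewrite !(ReD, ReN) /= => /eqP; apply/negP; rewrite gt_eqF//.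
    by rewrite addrAC opprB; have : 0 < e / 2 by [rewrite divr_gt0]; lra.
  + by move=> s /= sK _; exact: hurwitz_contE.
Unshelve. all: by end_near. Qed.

Lemma hurwitzP : is_hurwitz q (fun s => hurwitz s q).
Proof.
rewrite /hurwitz; case: xgetP => [f ->//|/(_ hurwitz_cont)]; case; exact: is_hurwitz_cont.
Qed.

End HurwitzExists.

(** * Meromorphic functions *)

Section MeromorphicClosure.
Context {R : realType} {V : normedModType R[i]}.
Implicit Types (F G : V -> Cplx R).

Lemma meromorphic_entire F : (forall x, differentiable F x) -> meromorphic F.
Proof.
move=> dF z0; exists setT, F, (fun=> 1); split.
- exact: openT.
- by [].
- by split=> z _; [exact: dF|exact: cdiff_cst].
- by move=> z _ /nbhs_singleton /eqP; rewrite oner_eq0.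
- by move=> z _ _; rewrite invr1 mulr1.
Qed.

Lemma meromorphic_ext F G : F =1 G -> meromorphic F -> meromorphic G.
Proof. by move=> /funext ->. Qed.

(** If the product vanishes near z and h1 is nonzero at some y close to z, then by continuity h1 has
    no zero near y, so h2 vanishes identically near y. This is why nonvanishing is asked at all
    points of U. *)
Lemma nonvanishingM (U : set V) (h1 h2 : V -> Cplx R) : open U ->
  (forall z, U z -> differentiable h1 z) ->
  (forall z, U z -> ~ (\forall y \near z, h1 y = 0)) ->
  (forall z, U z -> ~ (\forall y \near z, h2 y = 0)) ->
  forall z, U z -> ~ (\forall y \near z, (h1 y : R[i]) * h2 y = 0).
Proof.
move=> oU dh1 n1 n2 z Uz h12.
apply: (n1 z Uz).
have Unear : \forall y \near z, U y by apply: open_nbhs_nbhs.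
have h12' : \forall y \near z, \forall x \near y, (h1 x : R[i]) * h2 x = 0.
  exact: nbhs_interior.
near=> y; apply/eqP/negPn/negP => h1y.
have Uy : U y by near: y.
apply: (n2 y Uy).
have c1 : h1 x @[x --> y] --> h1 y by apply: differentiable_continuous; exact: dh1.
have h1x : \forall x \near y, h1 x != 0.
  move/cvg_cmodP : c1 => /(_ (cmod (h1 y))); rewrite cmod_gt0 => /(_ h1y).
  by apply: filterS => x; apply: contraTneq => ->; rewrite subr0 ltxx.
have e : \forall x \near y, (h1 x : R[i]) * h2 x = 0 by near: y.
move: h1x e; apply: filterS2 => x h1x /eqP.
by rewrite mulf_eq0 => /orP[/eqP e|/eqP//]; rewrite e eqxx in h1x.
Unshelve. all: by end_near. Qed.

Lemma meromorphicM F G : meromorphic F -> meromorphic G ->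
  meromorphic ((fun y => (F y : R[i]) * (G y : R[i])) : V -> Cplx R).
Proof.
move=> mF mG z0; have [U1 [g1 [h1 [oU1 U1z [dg1 dh1] n1 e1]]]] := mF z0.
have [U2 [g2 [h2 [oU2 U2z [dg2 dh2] n2 e2]]]] := mG z0.
have oU : open (U1 `&` U2) by exact: openI.
exists (U1 `&` U2), (fun y => (g1 y : R[i]) * g2 y), (fun y => (h1 y : R[i]) * h2 y).
split; [exact: oU|by []| | |].
- by split=> z [z1 z2]; [exact: (cdiffM (dg1 z z1) (dg2 z z2))|
                         exact: (cdiffM (dh1 z z1) (dh2 z z2))].
- apply: (nonvanishingM oU) => z [z1 z2]; [exact: dh1|exact: n1|exact: n2].
move=> z [z1 z2]; rewrite mulf_eq0 negb_or => /andP[k1 k2].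
rewrite e1// e2//.
have alg (a b c d : R[i]) : c != 0 -> d != 0 -> (a / c) * (b / d) = (a * b) / (c * d).
  by move=> c0 d0; field; rewrite c0 d0.
exact: alg.
Qed.

Lemma meromorphicD F G : meromorphic F -> meromorphic G ->
  meromorphic ((fun y => (F y : R[i]) + (G y : R[i])) : V -> Cplx R).
Proof.
move=> mF mG z0; have [U1 [g1 [h1 [oU1 U1z [dg1 dh1] n1 e1]]]] := mF z0.
have [U2 [g2 [h2 [oU2 U2z [dg2 dh2] n2 e2]]]] := mG z0.
have oU : open (U1 `&` U2) by exact: openI.
exists (U1 `&` U2), (fun y => (g1 y : R[i]) * h2 y + (g2 y : R[i]) * h1 y),
  (fun y => (h1 y : R[i]) * h2 y).
split; [exact: oU|by []| | |].
- split=> z [z1 z2]; last exact: (cdiffM (dh1 z z1) (dh2 z z2)).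
  exact: (cdiffD (cdiffM (dg1 z z1) (dh2 z z2)) (cdiffM (dg2 z z2) (dh1 z z1))).
- apply: (nonvanishingM oU) => z [z1 z2]; [exact: dh1|exact: n1|exact: n2].
move=> z [z1 z2]; rewrite mulf_eq0 negb_or => /andP[k1 k2].
rewrite e1// e2//.
have alg (a b c d : R[i]) : c != 0 -> d != 0 ->
    a / c + b / d = (a * d + b * c) / (c * d).
  by move=> c0 d0; field; rewrite c0 d0.
exact: alg.
Qed.

Lemma meromorphic_sum (I : Type) (s : seq I) (F : I -> V -> R[i]) :
  (forall i, meromorphic (F i : V -> Cplx R)) ->
  meromorphic ((fun y => \sum_(i <- s) F i y) : V -> Cplx R).
Proof.
move=> mF; elim: s => [|i s IH].
  by apply: meromorphic_entire => x; under eq_fun do rewrite big_nil; exact: cdiff_cst.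
by apply: meromorphic_ext (meromorphicD (mF i) IH) => y; rewrite big_cons.
Qed.

Lemma meromorphic_prod (I : Type) (s : seq I) (F : I -> V -> R[i]) :
  (forall i, meromorphic (F i : V -> Cplx R)) ->
  meromorphic ((fun y => \prod_(i <- s) F i y) : V -> Cplx R).
Proof.
move=> mF; elim: s => [|i s IH].
  by apply: meromorphic_entire => x; under eq_fun do rewrite big_nil; exact: cdiff_cst.
by apply: meromorphic_ext (meromorphicM (mF i) IH) => y; rewrite big_cons.
Qed.

(* The line in direction v through x is a section of A at A x, hence A is
   open, which keeps denominators from vanishing identically. *)
Lemma meromorphic_comp (F : Cplx R -> Cplx R) (A : V -> Cplx R) (v : V) :
  meromorphic F -> (forall x, differentiable A x) ->
  (forall x (w : R[i]), A (x + (w - A x) *: v) = w) ->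
  meromorphic ((fun y => F (A y)) : V -> Cplx R).
Proof.
move=> mF dA Av z0; have [U [g [h [oU Uz [dg dh] n e]]]] := mF (A z0).
have cA : continuous A by move=> x; exact: differentiable_continuous.
exists (A @^-1` U), (fun y => g (A y)), (fun y => h (A y)); split.
- by apply: open_comp => // x _; exact: cA.
- exact: Uz.
- split=> z Az; [exact: (cdiff_comp (dA z) (dg _ Az))|
                 exact: (cdiff_comp (dA z) (dh _ Az))].
- move=> z Az hz; apply: (n _ Az).
  pose c (w : Cplx R) : V := z + ((w : R[i]) - A z) *: v.
  have cc : c w @[w --> A z] --> z.
    have cz : c (A z) = z by rewrite /c subrr scale0r addr0.
    rewrite -[X in _ --> X]cz; apply: differentiable_continuous.
    have dk := cdiffD (cdiff_id (A z)) (cdiff_cst (- A z) _).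
    exact: (differentiableD (differentiable_cst z _) (differentiableZl v dk)).
  have hc : \forall w \near (A z : Cplx R), h (A (c w)) = 0 by exact: (cc _ hz).
  by near=> w; rewrite -(Av z w); near: w.
- by move=> z /=; exact: e.
Unshelve. all: by end_near. Qed.

End MeromorphicClosure.

(** * Counting homomorphisms to cyclic groups *)

Section CountingHom.

(** [card_Hom] counts functions on a possibly infinite group through [fset_set], which is
    informative on finite sets only; an injective parametrization by a finite type gives finiteness
    and cardinality at once. *)
Lemma card_fset_set_range (T : choiceType) (F : finType) (phi : F -> T) (A : set T) :
  injective phi -> (forall x, A x <-> exists y, phi y = x) ->
  #|` fset_set A|%fset = #|F|.
Proof.
move=> phi_inj AE.
have -> : A = [set` [fset phi y | y in F]%fset].
  apply/seteqP; split => x.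
    by move=> /AE[y <-] /=; apply/imfsetP; exists y.
  by move=> /= /imfsetP[y _ ->]; apply/AE; exists y.
by rewrite set_fsetK card_imfset//= cardE.
Qed.

Definition ffhom (Gamma : finZmodType) (M : nat) : pred {ffun Gamma -> 'I_M.+1} :=
  fun h => [forall x, forall y, h (x + y) == h x + h y].

Lemma ffhomP (Gamma : finZmodType) (M : nat) (h : {ffun Gamma -> 'I_M.+1}) :
  reflect {morph h : x y / x + y} (ffhom h).
Proof.
apply: (iffP forallP) => [hh x y|hh x].
  by have /forallP/(_ y)/eqP := hh x.
by apply/forallP => y; rewrite hh.
Qed.

Lemma morph_add0 (U W : zmodType) (h : U -> W) : {morph h : x y / x + y} -> h 0 = 0.
Proof. by move=> hh; apply: (addrI (h 0)); rewrite -hh !addr0. Qed.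

Lemma morph_addMn (U W : zmodType) (h : U -> W) n x :
  {morph h : x y / x + y} -> h (x *+ n) = h x *+ n.
Proof.
move=> hh; elim: n => [|n IH]; first by rewrite !mulr0n morph_add0.
by rewrite !mulrS hh IH.
Qed.

Lemma morph_addMz (U W : zmodType) (h : U -> W) (z : int) x :
  {morph h : x y / x + y} -> h (x *~ z) = h x *~ z.
Proof.
move=> hh; have hN y : h (- y) = - h y.
  by apply: (addrI (h y)); rewrite -hh !subrr morph_add0.
case: z => n; first by rewrite -!pmulrn morph_addMn.
by rewrite !NegzE !mulrNz hN -!pmulrn morph_addMn.
Qed.

Lemma morph_add_sum (U W : zmodType) (h : U -> W) (I : Type) (s : seq I) (F : I -> U) :
  {morph h : x y / x + y} -> h (\sum_(i <- s) F i) = \sum_(i <- s) h (F i).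
Proof. by move=> hh; apply: big_morph => //; exact: morph_add0. Qed.

Lemma card_Hom_fin (Gamma : finZmodType) (m : nat) :
  card_Hom Gamma m = #|{: {h | @ffhom Gamma m.-1 h}}|.
Proof.
apply: (card_fset_set_range
  (phi := fun h : {h | @ffhom Gamma m.-1 h} => (val h : Gamma -> _))).
  by move=> h h' e; apply: val_inj; apply/ffunP => x; rewrite e.
move=> g; split => [hg|[[h /ffhomP hh] <-]//].
have gP : ffhom [ffun x => g x] by apply/ffhomP => x y; rewrite !ffunE hg.
exists (exist (fun h => is_true (ffhom h)) [ffun x => g x] gP).
by apply/funext => x; rewrite /= ffunE.
Qed.

(** A homomorphism on Z^n x Gamma amounts to a free choice of the images of the n basis vectors and
    a homomorphism on Gamma. *)
Lemma card_Hom_prod (G : zmodType) (Gamma : finZmodType) (n m : nat)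
    (f : {additive G -> ('rV[int]_n * Gamma)%type}) :
  bijective f -> (0 < m)%N -> card_Hom G m = (m ^ n * card_Hom Gamma m)%N.
Proof.
move=> [g gK fK]; case: m => // M _; rewrite [in RHS]card_Hom_fin.
pose F := ({ffun 'I_n -> 'I_M.+1} * {h | @ffhom Gamma M h})%type.
have gD : {morph g : x y / x + y}.
  by move=> x y; apply: (can_inj gK); rewrite raddfD !fK.
pose phi (ch : F) (x : G) : 'I_M.+1 :=
  \sum_(i < n) ch.1 i *~ (f x).1 0 i + val ch.2 (f x).2.
transitivity #|{: F}|; last by rewrite card_prod card_ffun !card_ord.
apply: (card_fset_set_range (phi := phi)).
  move=> [c [h hP]] [c' [h' hP']] e; have := ffhomP _ hP; have := ffhomP _ hP' => hh' hh.
  have cc : c = c'.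
    apply/ffunP => i; have := congr1 (fun k => k (g (delta_mx 0 i, 0))) e.
    rewrite /phi /= fK /= (morph_add0 hh) (morph_add0 hh') !addr0.
    have E (b : {ffun 'I_n -> 'I_M.+1}) :
        \sum_(j < n) b j *~ (delta_mx 0 i : 'rV[int]_n) 0 j = b i.
      rewrite (bigD1 i)//= big1 ?addr0 => [|j /negPf ji]; rewrite mxE ?eqxx ?ji //.
    by rewrite !E.
  subst c'; congr (_, _); apply: val_inj => /=; apply/ffunP => x.
  have := congr1 (fun k => k (g (0, x))) e.
  rewrite /phi /= fK /= !big1; last by move=> j _; rewrite mxE mulr0z.
  by rewrite !add0r.
move=> k; split => [hk|[[c [h hP]] <-]]; last first.
  have hh := ffhomP _ hP; move=> x y; rewrite /phi /= raddfD /= hh addrACA; congr (_ + _).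
  by rewrite -big_split /=; apply: eq_bigr => i _; rewrite mxE mulrzDr.
have hP : @ffhom Gamma M [ffun x => k (g (0, x))].
  apply/ffhomP => x y; rewrite !ffunE -hk -gD; congr (k (g _)).
  by congr (_, _) => /=; rewrite addr0.
exists ([ffun i => k (g (delta_mx 0 i, 0))], exist (fun h => is_true (ffhom h)) _ hP).
apply/funext => x; rewrite /phi /= ffunE.
have -> : \sum_(i < n) [ffun i => k (g (delta_mx 0 i, 0))] i *~ (f x).1 0 i =
    k (g ((f x).1, 0)).
  have -> : ((f x).1, 0) = \sum_(i < n) (delta_mx 0 i, 0) *~ (f x).1 0 i
      :> ('rV[int]_n * Gamma)%type.
    have pD : {morph (fun u : 'rV[int]_n => (u, 0) : 'rV[int]_n * Gamma) : u v / u + v}.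
      by move=> u v; congr (_, _); rewrite addr0.
    rewrite [in LHS](row_sum_delta (f x).1) (morph_add_sum _ _ pD).
    apply: eq_bigr => i _; rewrite -(morph_addMz _ _ pD); congr (_, _).
    by rewrite -scaler_int intz.
  rewrite (morph_add_sum _ _ gD) (morph_add_sum _ _ hk); apply: eq_bigr => i _.
  by rewrite (morph_addMz _ _ gD) (morph_addMz _ _ hk) ffunE.
rewrite -hk -gD -[in RHS](gK x); congr (k (g _)).
by rewrite [RHS]surjective_pairing; congr (_, _); rewrite /= ?addr0 ?add0r.
Qed.

Lemma mulrn_lcm_orders (Gamma : finZmodType) (x : Gamma) : x *+ lcm_orders Gamma = 0.
Proof.
have : (#[x]%g %| lcm_orders Gamma)%N by rewrite /lcm_orders (bigD1 x)//= dvdn_lcml.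
move=> /dvdnP[k ->]; rewrite mulnC mulrnA.
have -> : x *+ #[x]%g = 0 by exact: (expg_order x).
by rewrite mul0rn.
Qed.

Lemma lcm_orders_gt0 (Gamma : finZmodType) : (0 < lcm_orders Gamma)%N.
Proof.
rewrite /lcm_orders; elim/big_ind: _ => // x y x0 y0.
by rewrite lcmn_gt0 x0.
Qed.

Lemma val_Zp_mulrn M (x : 'I_M.+1) k : (x *+ k : 'I_M.+1) = (k * x %% M.+1)%N :> nat.
Proof.
elim: k => [|k IH]; first by rewrite mulr0n mul0n mod0n.
by rewrite mulrS /= IH modnDmr mulSn.
Qed.

(** Elements of Gamma are killed by l, so homomorphisms land in the l-torsion of Z/m. With d =
    gcd(m, l) and e = m / d, that subgroup consists of the multiples of e and is a copy of Z/d, with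
    y sent to e y. *)
Lemma card_Hom_gcd (Gamma : finZmodType) (m : nat) : (0 < m)%N ->
  card_Hom Gamma m = card_Hom Gamma (gcdn m (lcm_orders Gamma)).
Proof.
move=> m0; set l := lcm_orders Gamma; set d := gcdn m l.
have d0 : (0 < d)%N by rewrite gcdn_gt0 m0.
have l0 : (0 < l)%N := lcm_orders_gt0 Gamma.
have dm : (d %| m)%N := dvdn_gcdl m l.
pose e := (m %/ d)%N; have e0 : (0 < e)%N by rewrite divn_gt0// dvdn_leq.
have mE : m = (e * d)%N by rewrite /e divnK.
rewrite [in RHS]card_Hom_fin.
have mS : m = m.-1.+1 by rewrite prednK.
have dS : d = d.-1.+1 by rewrite prednK.
have lt_d (y : 'I_d.-1.+1) : (y < d)%N by rewrite [X in (_ < X)%N]dS.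
have lt_m (y : 'I_d.-1.+1) : (e * y < m.-1.+1)%N by rewrite -mS mE ltn_pmul2l.
pose phi (h : {h | @ffhom Gamma d.-1 h}) (x : Gamma) : 'I_m.-1.+1 :=
  Ordinal (lt_m (val h x)).
have valD_m (a b : 'I_m.-1.+1) : (a + b : 'I_m.-1.+1) = ((a + b) %% m)%N :> nat.
  by rewrite [X in (_ %% X)%N]mS.
have valD_d (a b : 'I_d.-1.+1) : (a + b : 'I_d.-1.+1) = ((a + b) %% d)%N :> nat.
  by rewrite [X in (_ %% X)%N]dS.
apply: (card_fset_set_range (phi := phi)).
  move=> h h' eh; apply: val_inj; apply/ffunP => x.
  have /(congr1 (@nat_of_ord _)) /= := congr1 (fun k => k x) eh.
  by move/eqP; rewrite eqn_pmul2l// => /eqP; exact: val_inj.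
move=> g; split => [hg|[[h hP] <-]]; last first.
  have hh := ffhomP _ hP; move=> x y; apply: ord_inj.
  by rewrite valD_m /= hh valD_d -mulnDr [in RHS]mE muln_modr.
have eg x : (e %| g x)%N.
  have := congr1 (@nat_of_ord _) (morph_addMn l x hg).
  rewrite /l mulrn_lcm_orders (morph_add0 hg) -/l val_Zp_mulrn => h.
  have : (m %| l * g x)%N by rewrite /dvdn [X in (_ %% X)%N]mS -h.
  rewrite [X in (X %| _)%N]mE (_ : l = (l %/ d) * d)%N; last by rewrite divnK// dvdn_gcdr.
  rewrite mulnAC dvdn_pmul2r// Gauss_dvdr//.
  (* e and l / d are coprime: multiplied by d they give back m and l, whose gcd is d. *)
  rewrite coprime_sym /coprime -(eqn_pmul2r d0) mul1n muln_gcdl.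
  by rewrite divnK ?dvdn_gcdr// -mE gcdnC.
pose h0 (x : Gamma) : nat := (g x %/ e)%N.
have lt_h0 x : (h0 x < d.-1.+1)%N.
  by rewrite -dS /h0 ltn_divLR// mulnC -mE [X in (_ < X)%N]mS.
pose h := [ffun x => Ordinal (lt_h0 x)].
have hE x : (e * h x)%N = g x by rewrite ffunE /= /h0 mulnC divnK.
have hP : @ffhom Gamma d.-1 h.
  apply/ffhomP => x y; apply: ord_inj; apply/eqP; rewrite -(eqn_pmul2l e0); apply/eqP.
  have gxy : (g (x + y) : nat) = ((g x + g y) %% m)%N.
    by rewrite -valD_m; congr nat_of_ord; exact: hg.
  by rewrite hE gxy -!hE valD_d muln_modr -mulnDr -mE.
exists (exist (fun h => is_true (ffhom h)) h hP); apply/funext => x; apply: val_inj.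
by rewrite /= hE.
Qed.

Lemma card_Hom_mod (Gamma : finZmodType) (m m' : nat) : (0 < m)%N -> (0 < m')%N ->
  m = m' %[mod lcm_orders Gamma] -> card_Hom Gamma m = card_Hom Gamma m'.
Proof.
by move=> m0 m'0 mm; rewrite card_Hom_gcd// [RHS]card_Hom_gcd// -gcdn_modl mm gcdn_modl.
Qed.

(** Positivity makes these cardinals legitimate bases of [cpow]. *)
Lemma card_Hom_gt0 (Gamma : finZmodType) (m : nat) : (0 < card_Hom Gamma m)%N.
Proof.
rewrite card_Hom_fin; apply/card_gt0P.
have hP : @ffhom Gamma m.-1 [ffun=> 0] by apply/ffhomP => x y; rewrite !ffunE addr0.
by exists (exist (fun h => is_true (ffhom h)) _ hP).
Qed.

End CountingHom.

(** * Unconditional summation over boxes *)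

Section UnconditionalSums.
Context {R : realType} {T : choiceType}.
Implicit Types (u : T -> R[i]) (A B D : {fset T}).

Lemma abs_summable u (b : R) :
  (forall A, \sum_(i <- A) cmod (u i) <= b) ->
  esum.summable [set: T] (fun i => (cmod (u i))%:E).
Proof.
move=> ub; apply: (@le_lt_trans _ _ b%:E); last exact: ltry.
apply: ge_ereal_sup => _ [A [finA _] <-].
rewrite fsbig_finite//=.
rewrite (eq_bigr (fun i => (cmod (u i))%:E)); last first.
  by move=> i _; rewrite /= ger0_norm// cmod_ge0.
by rewrite sumEFin lee_fin.
Qed.

Lemma big_fset_split (M : zmodType) (F : T -> M) A B : (A `<=` B)%fset ->
  \sum_(i <- B) F i = \sum_(i <- A) F i + \sum_(i <- B | i \notin A) F i.
Proof.
move=> AB; rewrite (bigID (fun i => i \in A))/=; congr (_ + _).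
rewrite big_fset_condE; apply: eq_fbigl => i; rewrite !inE/=.
by rewrite andbC; case iA : (i \in A) => //=; apply: (fsubsetP AB).
Qed.

(** Once [D N] contains a set [A0] whose absolute sum is within e / 2 of the supremum, anything
    added to [D N] has absolute sum below e / 2; so the limit along [D] is the limit over all finite
    sets. *)
Lemma sum_exhaustion u (b : R) (D : nat -> {fset T}) (l : R[i]) :
  (forall A, \sum_(i <- A) cmod (u i) <= b) ->
  (forall A, exists N, forall n, (N <= n)%N -> (A `<=` D n)%fset) ->
  ccvg (fun n => \sum_(i <- D n) u i) l ->
  summability.sum (u : T -> Cplx R) = l.
Proof.
move=> ub Dexh ul; rewrite /summability.sum.
have PF : ProperFilter (@summability.totally T) := summability.totally_filter.
have FF : Filter (@summability.totally T) by exact: _.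
apply: cvg_lim; first exact: norm_hausdorff.
apply/(@cvg_cmodP R _ _ FF) => e e0.
have e2 : 0 < e / 2 by rewrite divr_gt0.
pose E : set R := [set x | exists A, x = \sum_(i <- A) cmod (u i)].
have supE : has_sup E.
  split; first by exists (\sum_(i <- fset0) cmod (u i)), fset0.
  by exists b => _ [A ->].
have [_ [A0 ->] supA0] := sup_adherent e2 supE.
have [N1 h1] := Dexh A0; have [N2 h2] := ul _ e2.
pose N := maxn N1 N2.
exists (D N) => // B /= DB.
have -> : summability.partial_sum (u : T -> Cplx R) B = \sum_(i <- B) u i.
  by rewrite big_seq_fsetE.
rewrite (big_fset_split u DB) opprD addrA.
apply: le_lt_trans (cmodB _ _) _; rewrite [ltRHS]splitr.
apply: ltr_leD; first by apply: h2; rewrite leq_maxr.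
apply: le_trans (cmod_sum _ _ _) _.
have BE : \sum_(i <- B) cmod (u i) <= sup E.
  by apply: sup_upper_bound => //; exists B.
have AD : \sum_(i <- A0) cmod (u i) <= \sum_(i <- D N) cmod (u i).
  rewrite (big_fset_split (fun i => cmod (u i)) (h1 N (leq_maxl _ _))) lerDl.
  by apply: sumr_ge0 => i _; exact: cmod_ge0.
rewrite (big_fset_split (fun i => cmod (u i)) DB) in BE.
by lra.
Qed.

End UnconditionalSums.

Section Boxes.
Context {R : realType} {I : finType}.
Implicit Types (A : {fset {ffun I -> nat}}).

Definition box_ffun N (m : {ffun I -> 'I_N}) : {ffun I -> nat} :=
  [ffun i => nat_of_ord (m i)].

Lemma box_ffun_inj N : injective (@box_ffun N).
Proof.
move=> m m' /ffunP e; apply/ffunP => i; apply: val_inj.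
by have := e i; rewrite !ffunE.
Qed.

Definition box N : {fset {ffun I -> nat}} :=
  [fset box_ffun m | m : {ffun I -> 'I_N}]%fset.

Lemma in_box N (m : {ffun I -> nat}) : (forall i, (m i < N)%N) -> m \in box N.
Proof.
move=> mN; apply/imfsetP; exists [ffun i => Ordinal (mN i)] => //.
by apply/ffunP => i; rewrite !ffunE.
Qed.

Lemma fsubset_box A : exists N, forall n, (N <= n)%N -> (A `<=` box n)%fset.
Proof.
exists (\max_(m <- A) \max_(i : I) m i).+1 => n Nn; apply/fsubsetP => m mA.
apply: in_box => i; apply: leq_trans Nn; rewrite ltnS.
have h := @leq_bigmax_seq _ (enum_fset A) xpredT
  (fun m : {ffun I -> nat} => \max_(i : I) m i)%N m mA isT.
by apply: leq_trans h; exact: (@leq_bigmax I (fun i => m i) i).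
Qed.

Lemma sum_box (M : nmodType) (F : {ffun I -> nat} -> M) N :
  \sum_(m <- box N) F m = \sum_(m : {ffun I -> 'I_N}) F (box_ffun m).
Proof.
rewrite /box big_imfset /=; last by move=> m m' _ _; exact: box_ffun_inj.
by rewrite big_enum.
Qed.

(** Enlarging the finite set to a box is harmless for nonnegative terms, and over a box the sum of
    products factors. *)
Lemma sum_prod_bound (b : I -> nat -> R) (B : I -> R) :
  (forall i n, 0 <= b i n) -> (forall i N, \sum_(0 <= n < N) b i n <= B i) ->
  forall A, \sum_(m <- A) \prod_i b i (m i) <= \prod_i B i.
Proof.
move=> b0 bB A; have [N /(_ N (leqnn N)) AN] := fsubset_box A.
apply: (@le_trans _ _ (\sum_(m <- box N) \prod_i b i (m i))).
  rewrite (big_fset_split (fun m : {ffun I -> nat} => \prod_i b i (m i)) AN) lerDl.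
  by apply: sumr_ge0 => m _; exact: prodr_ge0.
rewrite sum_box (eq_bigr (fun m : {ffun I -> 'I_N} => \prod_i b i (m i))); last first.
  by move=> m _; apply: eq_bigr => i _; rewrite ffunE.
rewrite -(bigA_distr_bigA (fun i (j : 'I_N) => b i j)).
apply: ler_prod => i _; rewrite sumr_ge0//=.
by have := bB i N; rewrite big_mkord.
Qed.

Lemma sum_residue (g : nat -> R[i]) (l k N : nat) : (k < l)%N ->
  \sum_(j < N * l | (j %% l == k)%N) g j = \sum_(0 <= t < N) g (t * l + k)%N.
Proof.
move=> kl; rewrite -(big_mkord (fun j => (j %% l == k)%N) g).
elim: N => [|N IH]; first by rewrite mul0n !big_geq.
rewrite big_nat_recr//= -IH (@big_cat_nat _ _ _ (N * l)%N)//=; last first.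
  by rewrite leq_mul2r leqnSn orbT.
congr (_ + _); rewrite mulSn -{1}[(N * l)%N]add0n big_addn addnK big_mkord.
rewrite (bigD1 (Ordinal kl))/=; last by rewrite addnC modnMDl modn_small.
rewrite addnC big1 ?addr0// => j; rewrite addnC modnMDl modn_small// => /andP[/eqP jk].
by case/negP; apply/eqP/val_inj.
Qed.

(** A side [N * l] meets every residue class modulo l exactly N times. On a class of indices the
    product of the m_i + 1 is constant modulo l, so c factors out and the rest splits into
    one-dimensional sums. *)
Lemma periodic_box_sum (c : nat -> R[i]) (g : I -> nat -> R[i]) (l N : nat) :
  (0 < l)%N ->
  (forall m m', (0 < m)%N -> (0 < m')%N -> m = m' %[mod l] -> c m = c m') ->
  \sum_(m <- box (N * l)) c (\prod_i (m i).+1)%N * \prod_i g i (m i) =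
  \sum_(k : {ffun I -> 'I_l}) c (\prod_i (k i).+1)%N *
     \prod_i \sum_(0 <= t < N) g i (t * l + k i)%N.
Proof.
move=> l0 cper; rewrite sum_box.
pose p (m : {ffun I -> 'I_(N * l)}) : {ffun I -> 'I_l} :=
  [ffun i => Ordinal (ltn_pmod (m i) l0)].
rewrite (partition_big p predT)//=; apply: eq_bigr => k _.
have prodmod (a b : I -> nat) : (forall i, a i = b i %[mod l]) ->
    (\prod_i a i)%N = (\prod_i b i)%N %[mod l].
  move=> ab; elim/big_ind2: _ => // x1 x2 y1 y2 e1 e2.
  by rewrite -modnMm e1 e2 modnMm.
transitivity (\sum_(m | p m == k) c (\prod_i (k i).+1)%N * \prod_i g i (m i)).
  apply: eq_bigr => m /eqP pk; congr (_ * _); last first.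
    by apply: eq_bigr => i _; rewrite ffunE.
  apply: cper; rewrite ?prodn_gt0//; apply: prodmod => i.
  by rewrite -pk !ffunE /= -addn1 -[in RHS]addn1 modnDml.
rewrite -mulr_sumr; congr (_ * _).
under [RHS]eq_bigr => i _ do rewrite -(sum_residue (g i) N (ltn_ord (k i))).
rewrite (bigA_distr_big_dep (fun i (j : 'I_(N * l)) => (j %% l == k i)%N)
  (fun i (j : 'I_(N * l)) => g i j)).
apply: eq_bigl => m; apply/eqP/familyP => [pk i|h].
  by rewrite -pk ffunE /= unfold_in /=.
by apply/ffunP => i; apply: val_inj; rewrite ffunE /=; apply/eqP; exact: h.
Qed.

Lemma periodic_sum (c : nat -> R[i]) (g : I -> nat -> R[i]) (l : nat)
    (B : I -> R) (S : I -> nat -> R[i]) :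
  (0 < l)%N ->
  (forall m m', (0 < m)%N -> (0 < m')%N -> m = m' %[mod l] -> c m = c m') ->
  (forall i N, \sum_(0 <= n < N) cmod (g i n) <= B i) ->
  (forall i k, (k < l)%N -> csums (fun t => g i (t * l + k)%N) (S i k)) ->
  let u := fun m : {ffun I -> nat} => c (\prod_i (m i).+1)%N * \prod_i g i (m i) in
  esum.summable [set: {ffun I -> nat}] (fun m => (cmod (u m))%:E) /\
  summability.sum (u : _ -> Cplx R) =
    \sum_(k : {ffun I -> 'I_l}) c (\prod_i (k i).+1)%N * \prod_i S i (k i).
Proof.
move=> l0 cper gB gS u.
(* By periodicity the values of c at positive integers are those at 1, ..., l, so the sum of their
   moduli bounds it. *)
pose cmax := \sum_(k < l) cmod (c k.+1).
have c_le m : (0 < m)%N -> cmod (c m) <= cmax.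
  move=> m0; have kl : (m.-1 %% l < l)%N by rewrite ltn_pmod.
  have -> : c m = c (m.-1 %% l).+1.
    by apply: cper => //; rewrite -addn1 modnDml addn1 prednK.
  rewrite /cmax (bigD1 (Ordinal kl))//= lerDl.
  by apply: sumr_ge0 => i _; exact: cmod_ge0.
have ub A : \sum_(m <- A) cmod (u m) <= cmax * \prod_i B i.
  apply: le_trans (_ : \sum_(m <- A) cmax * \prod_i cmod (g i (m i)) <= _).
    apply: ler_sum => m _; rewrite /u cmodM cmod_prod ler_wpM2r//.
      by apply: prodr_ge0 => i _; exact: cmod_ge0.
    by apply: c_le; rewrite prodn_gt0.
  rewrite -mulr_sumr ler_wpM2l//.
    by apply: sumr_ge0 => i _; exact: cmod_ge0.
  apply: (sum_prod_bound (b := fun i n => cmod (g i n))) => // i n.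
  exact: cmod_ge0.
split; first exact: abs_summable ub.
(* Any exhaustion would give the sum; boxes with sides divisible by l are those that factor. *)
apply: (sum_exhaustion ub (D := fun N => box (N * l))).
  move=> A; have [N hN] := fsubset_box A; exists N => n Nn.
  by apply: hN; rewrite (leq_trans Nn)// leq_pmulr.
apply: (ccvg_ext (u := fun N => \sum_(k : {ffun I -> 'I_l}) c (\prod_i (k i).+1)%N *
     \prod_i \sum_(0 <= t < N) g i (t * l + k i)%N)).
  by move=> N; rewrite -periodic_box_sum.
apply: ccvg_sum => k; apply: ccvgZ; apply: ccvg_prod => i.
exact: gS.
Qed.

End Boxes.

(** * Reduction to Hurwitz series *)

Section ZetaTerms.
Context {R : realType}.
Implicit Types (a s q w : R[i]) (u : nat -> R[i]).

Definition abs_bounded u : Prop :=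
  exists b : R, forall N, \sum_(0 <= n < N) cmod (u n) <= b.

Lemma abs_boundedZ (c : R[i]) u : abs_bounded u -> abs_bounded (fun n => c * u n).
Proof.
move=> [b ub]; exists (cmod c * b) => N.
by under eq_bigr do rewrite cmodM; rewrite -mulr_sumr ler_wpM2l// cmod_ge0.
Qed.

Lemma abs_bounded_sum (I : Type) (t : seq I) (u : I -> nat -> R[i]) :
  (forall i, abs_bounded (u i)) -> abs_bounded (fun n => \sum_(i <- t) u i n).
Proof.
move=> ub; elim: t => [|i t [b hb]].
  by exists 0 => N; rewrite big1// => n _; rewrite big_nil cmod0.
have [b' hb'] := ub i; exists (b' + b) => N.
apply: le_trans (lerD (hb' N) (hb N)); rewrite -big_split /=.
by apply: ler_sum => n _; rewrite big_cons; exact: cmodD.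
Qed.

(** t l + k + a = l (t + (k + a) / l), and the positive factor l may be pulled out of the power. *)
Lemma csums_hurwitz_residue a s (l k : nat) :
  0 < complex.Re a -> (0 < l)%N -> 1 < complex.Re s ->
  csums (fun t => cpow ((t * l + k)%N%:R + a) (- s))
        (cpow l%:R (- s) * hurwitz s ((k%:R + a) / l%:R)).
Proof.
move=> a0 l0 s1; set q := (k%:R + a) / l%:R.
have lR : 0 < (l%:R : R) by rewrite ltr0n.
have q0 : 0 < complex.Re q.
  rewrite /q (natC l) -fmorphV ReM /= mulr0 subr0 mulr_gt0 ?invr_gt0//.
  by rewrite ReD Re_nat ltr_wpDl.
have -> : hurwitz s q = hurwitz_series s q by have [->] := hurwitzP q0.
apply: csums_ext (csumsZ (cpow l%:R (- s)) (hurwitz_csums q0 s1)) => t.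
have -> : (t * l + k)%N%:R + a = l%:R * (t%:R + q).
  have l1 : (l%:R : R[i]) != 0 by rewrite pnatr_eq0 -lt0n.
  by rewrite /q natrD natrM; field.
by rewrite {2}(natC l) cpowMr ?ReD ?Re_nat ?ltr_wpDl// -(natC l).
Qed.


Lemma cpow_card_Hom (G : zmodType) (Gamma : finZmodType) (n m : nat) w
    (f : {additive G -> ('rV[int]_n * Gamma)%type}) :
  bijective f -> (0 < m)%N ->
  cpow (card_Hom G m)%:R w = cpow m%:R (n%:R * w) * cpow (card_Hom Gamma m)%:R w.
Proof.
move=> bf m0; rewrite (card_Hom_prod bf m0) natrM (natC (m ^ n)) cpowMr.
- by rewrite -(natC (m ^ n)) cpow_natX.
- by rewrite ltr0n expn_gt0 m0.
- by rewrite Re_nat ltr0n card_Hom_gt0.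
Qed.

Section OneGroup.
Variables (r : nat) (G : zmodType) (Gamma : finZmodType) (n : nat).
Variable f : {additive G -> ('rV[int]_n * Gamma)%type}.
Hypothesis bij_f : bijective f.
Implicit Types (b : 'I_r -> R[i]) (x : 'rV[R[i]]_r).
Local Notation l := (lcm_orders Gamma).

Lemma zeta_termE x b w (m : {ffun 'I_r -> nat}) :
  zeta_term x b w G m = cpow (card_Hom Gamma (\prod_i (m i).+1))%:R w *
    \prod_i (cpow (m i).+1%:R (n%:R * w) * cpow ((m i).+1%:R - 1 + b i) (- x 0 i)).
Proof.
rewrite /zeta_term (cpow_card_Hom w bij_f) ?prodn_gt0//.
rewrite cpow_prod_nat// big_split /= !mulrA; congr (_ * _).
exact: mulrC.
Qed.

(** The sums [S] over residue classes stay abstract: they become single Hurwitz values when all a_i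
    are 1, and binomial combinations of such values when w is an integer. *)
Lemma zetaAb_residues x b w (S : 'I_r -> nat -> R[i]) :
  (forall i, abs_bounded
     (fun k => cpow k.+1%:R (n%:R * w) * cpow (k.+1%:R - 1 + b i) (- x 0 i))) ->
  (forall i k, (k < l)%N -> csums
     (fun t => cpow (t * l + k).+1%:R (n%:R * w) *
               cpow ((t * l + k).+1%:R - 1 + b i) (- x 0 i)) (S i k)) ->
  zeta_abs_cvg x b w G /\
  zetaAb x b w G =
    \sum_(k : {ffun 'I_r -> 'I_l})
      cpow (card_Hom Gamma (\prod_i (k i).+1))%:R w * \prod_i S i (k i).
Proof.
move=> /choice[B gB] gS.
have cper m m' : (0 < m)%N -> (0 < m')%N -> m = m' %[mod l] ->
    cpow (card_Hom Gamma m)%:R w = cpow (card_Hom Gamma m')%:R w.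
  by move=> m0 m'0 mm; rewrite (card_Hom_mod m0 m'0 mm).
have [h1 h2] := @periodic_sum R _ (fun m => cpow (card_Hom Gamma m)%:R w)
  (fun i k => cpow k.+1%:R (n%:R * w) * cpow (k.+1%:R - 1 + b i) (- x 0 i))
  l B S (lcm_orders_gt0 Gamma) cper gB gS.
have tE : zeta_term x b w G = fun m : {ffun 'I_r -> nat} =>
   cpow (card_Hom Gamma (\prod_i (m i).+1))%:R w *
    \prod_i (cpow (m i).+1%:R (n%:R * w) * cpow ((m i).+1%:R - 1 + b i) (- x 0 i)).
  by apply/funext => m; rewrite zeta_termE.
by rewrite /zeta_abs_cvg /zetaAb tE; split; [exact: h1|exact: h2].
Qed.

(** With shift 1 both powers in a term have the base m_i, so they merge into the exponent - (s_i - n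
    w) for every complex w. *)
Lemma zetaAb_one x w :
  (forall i, 1 + n%:R * complex.Re w < complex.Re (x 0 i)) ->
  zeta_abs_cvg x (fun=> 1) w G /\
  zetaAb x (fun=> 1) w G =
    \sum_(k : {ffun 'I_r -> 'I_l})
      cpow (card_Hom Gamma (\prod_i (k i).+1))%:R w *
      \prod_i (cpow l%:R (- (x 0 i - n%:R * w)) *
                hurwitz (x 0 i - n%:R * w) ((k i).+1%:R / l%:R)).
Proof.
move=> xw.
have gE (i : 'I_r) k : cpow k.+1%:R (n%:R * w) * cpow (k.+1%:R - 1 + 1) (- x 0 i) =
    cpow (k%:R + 1) (- (x 0 i - n%:R * w)).
  by rewrite subrK -cpowD natr1; congr cpow; ring.
have x1 i : 1 < complex.Re (x 0 i - n%:R * w).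
  by have := xw i; rewrite ReD ReN ReM Re_nat Im_nat mul0r subr0; lra.
apply: (zetaAb_residues (S := fun i k => cpow l%:R (- (x 0 i - n%:R * w)) *
                hurwitz (x 0 i - n%:R * w) (k.+1%:R / l%:R))).
  move=> i; have [B hB] := @hurwitz_abs_bound R 1 ltr01 _ (x1 i).
  by exists B => N; under eq_bigr do rewrite gE; exact: hB.
move=> i k kl.
have := @csums_hurwitz_residue 1 _ _ k ltr01 (lcm_orders_gt0 Gamma) (x1 i).
by rewrite -[k.+1%:R]natr1; apply: csums_ext => t; rewrite gE.
Qed.

Lemma zetaAb_nat x b (w : nat) :
  (forall i, 0 < complex.Re (b i)) ->
  (forall i, 1 + n%:R * complex.Re (w%:R : R[i]) < complex.Re (x 0 i)) ->
  zeta_abs_cvg x b w%:R G /\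
  zetaAb x b w%:R G =
    \sum_(j : {ffun 'I_r -> 'I_(n * w).+1})
    (\prod_(i < r) ('C(n * w, j i)%:R * (1 - b i) ^+ (n * w - j i)))
    * \sum_(k : {ffun 'I_r -> 'I_l})
        cpow (card_Hom Gamma (\prod_(i < r) (k i).+1))%:R w%:R
        * \prod_(i < r)
            (cpow l%:R (- (x 0 i - (j i)%:R))
             * hurwitz (x 0 i - (j i)%:R) (((k i).+1%:R - 1 + b i) / l%:R)).
Proof.
move=> b0 xw; set N := (n * w)%N.
pose c (i : 'I_r) (j : nat) : R[i] := 'C(N, j)%:R * (1 - b i) ^+ (N - j).
pose H (i : 'I_r) (j k : nat) : R[i] := cpow l%:R (- (x 0 i - j%:R))
             * hurwitz (x 0 i - j%:R) ((k.+1%:R - 1 + b i) / l%:R).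
have kE k : k.+1%:R - 1 = k%:R :> R[i] by rewrite -natr1 addrK.
have gE (i : 'I_r) k : cpow k.+1%:R (n%:R * w%:R) * cpow (k.+1%:R - 1 + b i) (- x 0 i) =
    \sum_(j < N.+1) c i j * cpow (k%:R + b i) (- (x 0 i - j%:R)).
  have kb0 : k%:R + b i != 0.
    rewrite -cmod_gt0 (lt_le_trans _ (Re_le_cmod _))// (lt_le_trans _ (ler_norm _))//.
    by rewrite ReD Re_nat ltr_wpDl.
  rewrite -natrM cpow_nat ?pnatr_eq0// kE.
  have -> : k.+1%:R = (1 - b i) + (k%:R + b i) by rewrite -natr1; ring.
  rewrite exprDn mulr_suml; apply: eq_bigr => j _.
  rewrite opprB cpowD cpow_nat// /c -mulr_natl; ring.
(* j <= n w, so the shift by j never exceeds the excess granted by the convergence region. *)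
have x1 i (j : 'I_N.+1) : 1 < complex.Re (x 0 i - j%:R).
  have := xw i; rewrite ReD ReN !Re_nat => h.
  have : (j%:R : R) <= n%:R * w%:R by rewrite -natrM ler_nat -ltnS.
  by lra.
have [h1 ->] : zeta_abs_cvg x b w%:R G /\ zetaAb x b w%:R G =
    \sum_(k : {ffun 'I_r -> 'I_l})
      cpow (card_Hom Gamma (\prod_i (k i).+1))%:R w%:R *
      \prod_i \sum_(j < N.+1) c i j * H i j (k i).
  apply: (zetaAb_residues (S := fun i k => \sum_(j < N.+1) c i j * H i j k)).
    move=> i; have [|B hB] := @abs_bounded_sum _ (index_enum 'I_N.+1)
        (fun j k => c i j * cpow (k%:R + b i) (- (x 0 i - j%:R))).
      by move=> j; apply: abs_boundedZ; exact: hurwitz_abs_bound (x1 i j).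
    by exists B => M; under eq_bigr do rewrite gE; exact: hB.
  move=> i k kl.
  apply: (csums_ext (u := fun t => \sum_(j < N.+1)
      c i j * cpow ((t * l + k)%N%:R + b i) (- (x 0 i - j%:R)))).
    by move=> t; rewrite gE.
  apply: csums_sum => j; apply: csumsZ; rewrite /H kE.
  exact: csums_hurwitz_residue (lcm_orders_gt0 Gamma) (x1 i j).
split=> //.
(* The product over i of sums over j is expanded into a sum over families (j_1, ..., j_r), which is
   then exchanged with the sum over k. *)
transitivity (\sum_(k : {ffun 'I_r -> 'I_l}) \sum_(j : {ffun 'I_r -> 'I_N.+1})
    cpow (card_Hom Gamma (\prod_i (k i).+1))%:R w%:R *
      ((\prod_i c i (j i)) * \prod_i H i (j i) (k i))).
  apply: eq_bigr => k _; rewrite -mulr_sumr; congr (_ * _).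
  rewrite (bigA_distr_bigA (fun i (j : 'I_N.+1) => c i j * H i j (k i))).
  by apply: eq_bigr => j _; rewrite big_split.
rewrite exchange_big /=; apply: eq_bigr => j _.
by rewrite mulr_sumr; apply: eq_bigr => k _; rewrite mulrCA.
Qed.

End OneGroup.

End ZetaTerms.

(** * Meromorphy of the explicit formulas *)

Section MeromorphicZeta.
Context {R : realType}.

Lemma meromorphic_cst {V : normedModType R[i]} (c : R[i]) : meromorphic ((fun=> c) : V -> Cplx R).
Proof. by apply: meromorphic_entire => x; exact: cdiff_cst. Qed.

Lemma meromorphic_hurwitz_comp {V : normedModType R[i]} (q c : R[i]) (A : V -> Cplx R) (v : V) :
  0 < complex.Re q -> (forall x, differentiable A x) ->
  (forall x (t : R[i]), A (x + (t - A x) *: v) = t) ->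
  meromorphic ((fun y => cpow c (- (A y : R[i])) * hurwitz (A y) q) : V -> Cplx R).
Proof.
move=> q0 dA Av; apply: meromorphicM.
  apply: meromorphic_entire => x; apply: cdiff_cpow.
  by have := cdiffM (cdiff_cst (-1) x) (dA x); under eq_fun do rewrite mulN1r.
have [_ _ mq] := hurwitzP q0.
exact: (meromorphic_comp mq dA Av).
Qed.

Local Notation rVC r := ('rV[R[i]]_r : normedModType R[i]).

Lemma cdiff_coord r (i : 'I_r) (x : rVC r) :
  differentiable ((fun y : 'rV[R[i]]_r => y 0 i) : rVC r -> Cplx R) x.
Proof. exact: differentiable_coord. Qed.

Lemma meromorphic_zetaHI_nat r (b : 'I_r -> R[i]) (w : nat) (X : finType) (n : X -> nat)
    (Gamma : X -> finZmodType) : (forall i, 0 < complex.Re (b i)) ->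
  meromorphic ((fun s : 'rV[R[i]]_r => zetaHI_nat s b w n Gamma) : 'rV[R[i]]_r -> Cplx R).
Proof.
move=> b0; rewrite /zetaHI_nat.
apply: meromorphic_sum => p; apply: meromorphic_sum => j; apply: (meromorphicM (meromorphic_cst _)).
apply: meromorphic_sum => k; apply: (meromorphicM (meromorphic_cst _)).
apply: meromorphic_prod => i.
apply: (@meromorphic_hurwitz_comp _ _ _
  (fun s : 'rV[R[i]]_r => s 0 i - (j i)%:R) (delta_mx 0 i)).
- have l0 := lcm_orders_gt0 (Gamma p).
  rewrite (natC (lcm_orders _)) -fmorphV mulrC ReM /= mul0r subr0.
  by rewrite mulr_gt0 ?invr_gt0 ?ltr0n// -natr1 addrK ReD Re_nat ltr_wpDl.
- move=> x; exact: (cdiffD (cdiff_coord i x) (cdiff_cst (- (j i)%:R) _)).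
- by move=> x t; rewrite !mxE !eqxx /= mulr1; ring.
Qed.

Lemma meromorphic_zetaHI_one r (X : finType) (n : X -> nat) (Gamma : X -> finZmodType) :
  meromorphic ((fun sw : 'rV[R[i]]_r * Cplx R => zetaHI_one sw.1 sw.2 n Gamma)
    : 'rV[R[i]]_r * Cplx R -> Cplx R).
Proof.
rewrite /zetaHI_one.
have d2 x : differentiable ((fun sw : 'rV[R[i]]_r * Cplx R => sw.2)
    : 'rV[R[i]]_r * Cplx R -> Cplx R) x.
  by apply: linear_differentiable => y; exact: cvg_snd.
have d1 i x : differentiable ((fun sw : 'rV[R[i]]_r * Cplx R => sw.1 0 i)
    : 'rV[R[i]]_r * Cplx R -> Cplx R) x.
  apply: (differentiable_comp _ (cdiff_coord i x.1)).
  by apply: linear_differentiable => y; exact: cvg_fst.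
apply: meromorphic_sum => p; apply: meromorphic_sum => k; apply: meromorphicM.
  by apply: meromorphic_entire => x; exact: cdiff_cpow.
apply: meromorphic_prod => i.
pose A (sw : 'rV[R[i]]_r * Cplx R) : R[i] := sw.1 0 i - (n p)%:R * (sw.2 : R[i]).
have dA x : differentiable (A : 'rV[R[i]]_r * Cplx R -> Cplx R) x.
  have -> : A = fun sw => (sw.1 0 i : R[i]) + (- (n p)%:R) * (sw.2 : R[i]).
    by apply/funext => sw; rewrite /A mulNr.
  exact: (cdiffD (d1 i x) (cdiffM (cdiff_cst (- (n p)%:R) x) (d2 x))).
(* Moving s_i alone, with w fixed, changes [A] at unit rate, whatever the rank n p. *)
have Av x (t : R[i]) : A (x + (t - A x) *: (delta_mx 0 i, 0)) = t.
  rewrite /A /= !mxE !eqxx /= mulr1.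
  have -> : (t - A x) *: (0 : Cplx R) = 0 by exact: scaler0.
  by rewrite addr0 /A; ring.
have q0 : 0 < complex.Re (((k i).+1%:R : R[i]) / (lcm_orders (Gamma p))%:R).
  have l0 := lcm_orders_gt0 (Gamma p).
  rewrite (natC (lcm_orders _)) -fmorphV mulrC ReM /= mul0r subr0.
  by rewrite mulr_gt0 ?invr_gt0 ?ltr0n// Re_nat ltr0n.
exact: (meromorphic_hurwitz_comp _ q0 dA Av).
Qed.

End MeromorphicZeta.

(* X is given by its finite set of points and the groups of units G p of its
   stalks, written additively; G p is identified with Z^(n p) x Gamma p. *)
Theorem theorem0p1 (R : realType) (X : finType) (G : X -> zmodType)
  (G_fin_gen : forall p, fin_gen (G p))
  (n : X -> nat) (Gamma : X -> finZmodType)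
  (G_decomp : forall p, exists f : {additive G p -> ('rV[int]_(n p) * Gamma p)%type},
      bijective f)
  (r : nat) (r_gt0 : (0 < r)%N)
  (a : 'I_r -> R[i]) (a_gt0 : forall i, 0 < complex.Re (a i)) :
  (forall w : nat, (0 < w)%N ->
     [/\ forall s : 'rV[R[i]]_r, cvg_region n s w%:R ->
           forall p, zeta_abs_cvg s a w%:R (G p),
         forall s : 'rV[R[i]]_r, cvg_region n s w%:R ->
           zetaHI s a w%:R G = zetaHI_nat s a w n Gamma &
         meromorphic_continuation
           [set s : 'rV[R[i]]_r | cvg_region n s w%:R]
           (fun s => zetaHI s a w%:R G)
           (fun s => zetaHI_nat s a w n Gamma)])
  /\
  [/\ forall (s : 'rV[R[i]]_r) (w : R[i]), cvg_region n s w ->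
        forall p, zeta_abs_cvg s (fun=> 1) w (G p),
      forall (s : 'rV[R[i]]_r) (w : R[i]), cvg_region n s w ->
        zetaHI s (fun=> 1) w G = zetaHI_one s w n Gamma &
      meromorphic_continuation
        [set sw : 'rV[R[i]]_r * Cplx R | cvg_region n sw.1 sw.2]
        (fun sw => zetaHI sw.1 (fun=> 1) sw.2 G)
        (fun sw => zetaHI_one sw.1 sw.2 n Gamma)].
Proof.
split=> [w w0|].
  have eqn (s : 'rV[R[i]]_r) : cvg_region n s w%:R ->
      zetaHI s a w%:R G = zetaHI_nat s a w n Gamma.
    move=> sw; apply: eq_bigr => p _; have [f bf] := G_decomp p.
    exact: (zetaAb_nat bf a_gt0 (sw p)).2.
  split; [|exact: eqn|].
    move=> s sw p; have [f bf] := G_decomp p.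
    exact: (zetaAb_nat bf a_gt0 (sw p)).1.
  by split; [exact: meromorphic_zetaHI_nat|exact: eqn].
have eqn (s : 'rV[R[i]]_r) (w : R[i]) : cvg_region n s w ->
    zetaHI s (fun=> 1) w G = zetaHI_one s w n Gamma.
  move=> sw; apply: eq_bigr => p _; have [f bf] := G_decomp p.
  exact: (zetaAb_one bf (sw p)).2.
split; [|exact: eqn|].
  move=> s w sw p; have [f bf] := G_decomp p.
  exact: (zetaAb_one bf (sw p)).1.
by split; [exact: meromorphic_zetaHI_one|move=> [s w]; exact: eqn].
Qed.
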